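(* Let $R=\mathbb{Z}$ or $R=\mathbb{F}_p$ ($p$ a prime), let $X$ be a set, and let $\mathsf{T}_R(X)$ be the free binomial $\cup_1$-graded algebra over $R$ on $X$. Let $d\colon \mathsf{T}_R(X)\to \mathsf{T}_R(X)$ be an $R$-linear map of degree one satisfying the $\cup_1$–$d$ formula $$d(a\cup_1 b)=-a\cup b-b\cup a+da\cup_1 b+db\cup_1 a-da\circ db\qquad (a,b\in \mathsf{T}^1_R(X))$$ and the graded Leibniz rule $d(u\cup v)=du\cup v+(-1)^{|u|}u\cup dv$. Then $d^2(x)=0$ for all $x\in X$ if and only if $d^2(u)=0$ for all $u\in \mathsf{T}_R(X)$, in which case $(\mathsf{T}_R(X),d)$ is a binomial cup-one dga.
   Context: Free binomial algebra. For a set $X$, $\mathrm{Int}(\mathbb{Z}^X)=\{q\in\mathbb{Q}[X] : q(\mathbb{Z}^X)\subseteq\mathbb{Z}\}$, and $\mathrm{Int}(\mathbb{F}_p^X)$ is the quotient of $\mathrm{Int}(\mathbb{Z}^X)$ by the ideal generated by the elements $\zeta_n(x)=\binom{x}{n}$ ($x\in X$, $n\ge p$), tensored with $\mathbb{F}_p$. Let $\mathfrak{m}_{X,R}\subset \mathrm{Int}(R^X)$ be the $R$-submodule of polynomials with zero constant term. The free binomial $\cup_1$-graded algebra is the tensor algebra $\mathsf{T}_R(X)=T^*(\mathfrak{m}_{X,R})$ over $R$, so $\mathsf{T}^0=R$, $\mathsf{T}^1=\mathfrak{m}_{X,R}\supset X$; its product is written $\cup$ (equal to $\otimes$). It carries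 the $R$-linear maps $\cup_1\colon \mathsf{T}^1\otimes \mathsf{T}^1\to \mathsf{T}^1$, $a\cup_1 b=ab$ (product in $\mathrm{Int}(R^X)$); $\cup_1\colon \mathsf{T}^2\otimes \mathsf{T}^1\to \mathsf{T}^2$, $(a\otimes b)\cup_1 c=ac\otimes b+a\otimes bc$; and $\circ\colon \mathsf{T}^2\otimes \mathsf{T}^2\to \mathsf{T}^2$, $(a_1\otimes a_2)\circ(b_1\otimes b_2)=a_1b_1\otimes a_2b_2$. Binomial cup-one dga. A dga over $R$ is a graded $R$-algebra $A=\bigoplus_{i\ge0}A^i$ (product $\cup$) with a degree-one map $d$, $d^2=0$, satisfying the graded Leibniz rule. $D^2(A)\subset A^2$ is the $R$-span of all $a\cup b$, $a,b\in A^1$. A cup-one dga is a dga with $R$-linear maps $\cup_1\colon A^1\otimes_R A^1\to A^1$, $\cup_1\colon D^2(A)\otimes_R A^1\to A^2$, $\circ\colon D^2(A)\otimes_R D^2(A)\to D^2(A)$ such that: (i) $R\oplus A^1$, with multiplication given by that of $R$, scalar multiplication, and $\cup_1$ on $A^1$, is a commutative $R$-algebra with identity $1\in R$; (ii) $(a\cup b)\cup_1 c=a\cup(b\cup_1 c)+(a\cup_1 c)\cup b$ for $a,b,c\in A^1$; (iii) $(u\cup v)\circ(w\cup z)=(u\cup_1 w)\cup(v\cup_1 z)$ for $u,v,w,z\in A^1$; (iv) $a\cup_1 dc=a\cup c-c\cup a$ for $a\in A^1$, $c\in A^0$; (v) the $\cup_1$–$d$ formula above holds for all $a,b\in A^1$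 with $da,db\in D^2(A)$. An $R$-binomial algebra is: for $R=\mathbb{Z}$, a commutative ring, torsion-free as abelian group, in which $\binom{a}{n}=a(a-1)\cdots(a-n+1)/n!$ lies in the ring for all $a$ and $n>0$; for $R=\mathbb{F}_p$, a commutative $\mathbb{F}_p$-algebra with $a(a-1)\cdots(a-p+1)=0$ (equivalently $a^p=a$) for all $a$. A binomial cup-one dga is a cup-one dga such that $A^0$ (under $\cup$) and $R\oplus A^1$ (under $\cup_1$) are $R$-binomial algebras. *)

(* Defs.v *)
From HB Require Import structures.
From mathcomp Require Import all_boot all_order all_algebra finfield.
From mathcomp Require Import finmap boolp xfinmap monalg ring.

Set Implicit Arguments.
Unset Strict Implicit.
Unset Printing Implicit Defensive.

Import GRing.Theory Num.Theory.
Local Open Scope ring_scope.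
Local Open Scope quotient_scope.

Local Notation "1" := (@mone _) : monom_scope.
Local Notation "x * y" := (mmul x y) : monom_scope.

Section GeneratedIdeal.
Variables (A : nzRingType) (G : A -> Prop).

Definition two_sided_ideal (J : A -> Prop) : Prop :=
  [/\ J 0, forall x y, J x -> J y -> J (x - y) &
      forall u x v, J x -> J (u * x * v)].

Definition gen_ideal (x : A) : Prop :=
  forall J, two_sided_ideal J -> (forall g, G g -> J g) -> J x.

Lemma gen_ideal_two_sided : two_sided_ideal gen_ideal.
Proof.
split=> [J [] //|x y hx hy J hJ GJ|u x v hx J hJ GJ].
  by case: (hJ) => _ h _; apply: h; [apply: hx|apply: hy].
by case: (hJ) => _ _ h; apply: h; apply: hx.
Qed.

Definition gen_idealb : A -> bool := fun x => `[< gen_ideal x >].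

Lemma gen_idealb_zmod_closed : zmod_closed gen_idealb.
Proof.
have [h0 hB _] := gen_ideal_two_sided.
by split=> [|x y /asboolP hx /asboolP hy]; apply/asboolP; [|apply: hB].
Qed.

HB.instance Definition _ :=
  GRing.isZmodClosed.Build A gen_idealb gen_idealb_zmod_closed.

Definition gen_idealz : zmodClosed A := GRing.ZmodClosed.clone A gen_idealb _.

Lemma kernel_core_two_sided (V : zmodType) (f : {additive A -> V}) :
  two_sided_ideal (fun y => forall u v : A, f (u * y * v) = 0).
Proof.
split=> [u v|x y hx hy u v|a x b hx u v].
- by rewrite mulr0 mul0r raddf0.
- by rewrite mulrBr mulrBl raddfB hx hy subrr.
- by rewrite !mulrA -[_ * b * v]mulrA hx.
Qed.

Lemma gen_ideal_gen g : G g -> gen_ideal g.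
Proof. by move=> Gg J _; apply. Qed.

(* Properness is recorded in the type because [nzRingType] is non-trivial. *)
Definition ring_quot of ~ gen_ideal 1 : Type := Quotient.quot gen_idealz.

End GeneratedIdeal.

Section RingQuotient.
Variables (A : nzRingType) (G : A -> Prop) (ntG : ~ gen_ideal G 1).
Local Notation Q := (ring_quot ntG).

HB.instance Definition _ := GRing.Zmodule.on Q.

(* Locked, so that unification does not unfold the product of a quotient. *)
Fact rproj_key : unit. Proof. by []. Qed.
Definition rproj : A -> Q :=
  locked_with rproj_key (fun x => \pi_(Quotient.quot (gen_idealz G)) x).
Definition rrepr : Q -> A :=
  locked_with rproj_key (fun x => repr (x : Quotient.quot (gen_idealz G))).

Lemma rreprK : cancel rrepr rproj.
Proof. by move=> x; rewrite /rproj /rrepr !locked_withE; apply: reprK. Qed.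

Lemma rproj_eq x y : rproj x = rproj y <-> gen_ideal G (x - y).
Proof.
rewrite /rproj locked_withE; split=> [/eqP|h].
  by rewrite -Quotient.idealrBE => /asboolP.
by apply/eqP; rewrite -Quotient.idealrBE; apply/asboolP.
Qed.

Lemma rprojB : zmod_morphism rproj.
Proof. by move=> x y; rewrite /rproj locked_withE raddfB. Qed.

HB.instance Definition _ := GRing.isZmodMorphism.Build A Q rproj rprojB.

Definition rq_one : Q := rproj 1.
Definition rq_mul (x y : Q) : Q := rproj (rrepr x * rrepr y).

Lemma rrepr_proj x : gen_ideal G (rrepr (rproj x) - x).
Proof. by apply/rproj_eq; rewrite rreprK. Qed.

Lemma rq_mulE x y : rq_mul (rproj x) (rproj y) = rproj (x * y).
Proof.
apply/rproj_eq; have [h0 hB hM] := gen_ideal_two_sided G.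
rewrite (_ : _ - _ = 1 * (rrepr (rproj x) - x) * rrepr (rproj y)
  - (x * (y - rrepr (rproj y)) * 1)).
  apply: (hB); apply: hM; first exact: rrepr_proj.
  by rewrite -opprB -[- _]add0r; apply: hB => //; apply: rrepr_proj.
by rewrite mul1r mulr1 mulrBl mulrBr opprB addrA subrK.
Qed.

Lemma rq_ind (P : Q -> Prop) : (forall x, P (rproj x)) -> forall x, P x.
Proof. by move=> h x; rewrite -[x]rreprK. Qed.

Lemma rq_mulA : associative rq_mul.
Proof.
by elim/rq_ind=> x; elim/rq_ind=> y; elim/rq_ind=> z; rewrite !rq_mulE mulrA.
Qed.
Lemma rq_mul1r : left_id rq_one rq_mul.
Proof. by elim/rq_ind=> x; rewrite rq_mulE mul1r. Qed.
Lemma rq_mulr1 : right_id rq_one rq_mul.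
Proof. by elim/rq_ind=> x; rewrite rq_mulE mulr1. Qed.
Lemma rq_mulDl : left_distributive rq_mul +%R.
Proof.
elim/rq_ind=> x; elim/rq_ind=> y; elim/rq_ind=> z.
by rewrite -raddfD !rq_mulE mulrDl raddfD.
Qed.
Lemma rq_mulDr : right_distributive rq_mul +%R.
Proof.
elim/rq_ind=> x; elim/rq_ind=> y; elim/rq_ind=> z.
by rewrite -raddfD !rq_mulE mulrDr raddfD.
Qed.
Lemma rq_one_neq0 : rq_one != 0.
Proof.
apply/eqP; rewrite -(raddf0 rproj) => /rproj_eq; rewrite subr0; exact: ntG.
Qed.

HB.instance Definition _ := GRing.Zmodule_isNzRing.Build Q
  rq_mulA rq_mul1r rq_mulr1 rq_mulDl rq_mulDr rq_one_neq0.

Lemma rproj_monoid_morphism : monoid_morphism rproj.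
Proof. by split=> // x y; rewrite -rq_mulE. Qed.

HB.instance Definition _ :=
  GRing.isMonoidMorphism.Build A Q rproj rproj_monoid_morphism.

End RingQuotient.

Section ComRingQuotient.
Variables (A : comNzRingType) (G : A -> Prop) (ntG : ~ gen_ideal G 1).

Lemma rq_mulC : @commutative (ring_quot ntG) _ *%R.
Proof. by elim/rq_ind=> x; elim/rq_ind=> y; rewrite -!rmorphM mulrC. Qed.

HB.instance Definition _ :=
  GRing.PzRing_hasCommutativeMul.Build (ring_quot ntG) rq_mulC.

End ComRingQuotient.

Section LalgQuotient.
Variables (R : comNzRingType) (A : lalgType R) (G : A -> Prop).
Variable ntG : ~ gen_ideal G 1.
Local Notation Q := (ring_quot ntG).

Definition rq_scale (c : R) (x : Q) : Q := rproj ntG (c *: rrepr x).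

Lemma rq_scaleE c x : rq_scale c (rproj ntG x) = rproj ntG (c *: x).
Proof.
apply/rproj_eq; have [_ _ hM] := gen_ideal_two_sided G.
rewrite -scalerBr -[X in c *: X]mul1r scalerAl -[X in gen_ideal _ X]mulr1.
by apply: hM; apply: rrepr_proj.
Qed.

Lemma rq_scaleA a b x : rq_scale a (rq_scale b x) = rq_scale (a * b) x.
Proof. by elim/rq_ind: x => x; rewrite !rq_scaleE scalerA. Qed.
Lemma rq_scale1 : left_id 1 rq_scale.
Proof. by elim/rq_ind=> x; rewrite rq_scaleE scale1r. Qed.
Lemma rq_scaleDr : right_distributive rq_scale +%R.
Proof.
move=> c; elim/rq_ind=> x; elim/rq_ind=> y.
by rewrite -raddfD !rq_scaleE scalerDr raddfD.
Qed.
Lemma rq_scaleDl x : {morph rq_scale^~ x : a b / a + b}.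
Proof. by move=> a b; elim/rq_ind: x => x; rewrite !rq_scaleE scalerDl raddfD. Qed.

HB.instance Definition _ := GRing.Zmodule_isLmodule.Build R Q
  rq_scaleA rq_scale1 rq_scaleDr rq_scaleDl.

Lemma rproj_scalable : scalable (rproj ntG).
Proof. by move=> c x; apply: (esym (rq_scaleE c x)). Qed.

Lemma rq_scaleAl (c : R) (x y : Q) : c *: (x * y) = c *: x * y.
Proof.
elim/rq_ind: x => x; elim/rq_ind: y => y; have scE := rproj_scalable.
by rewrite -rmorphM -!scE -rmorphM scalerAl.
Qed.

HB.instance Definition _ := GRing.Lmodule_isLalgebra.Build R Q rq_scaleAl.

HB.instance Definition _ := 
  GRing.isScalable.Build R A Q _ (rproj ntG) rproj_scalable.

End LalgQuotient.

Definition linear_rel (R : comNzRingType) (M : lmodType R) (F : lalgType R)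
    (L : M -> F) (r : F) : Prop :=
  exists (c : R) (a b : M), r = L (c *: a + b) - (c *: L a + L b).

Lemma linear_rel_ker (R : comNzRingType) (M : lmodType R) (F : lalgType R)
    (L : M -> F) (V : lmodType R) (f : {linear F -> V}) (S : F -> F -> M -> V) :
  (forall (c : R) (x y : F), c *: (x * y) = x * (c *: y)) ->
  (forall u v z, f (u * L z * v) = S u v z) ->
  (forall u v, linear (S u v)) ->
  forall x, gen_ideal (linear_rel L) x -> f x = 0.
Proof.
move=> scAr fS Slin x /(_ _ (kernel_core_two_sided f)) h.
rewrite -[x]mul1r -[_ * x]mulr1; apply: h => _ [c [a [b ->]]] u v.
rewrite mulrBr mulrDr -scAr mulrBl mulrDl -scalerAl.
by apply: etrans (linearB f _ _) _; rewrite linearP !fS Slin subrr.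
Qed.

Lemma sandwich_sum (A : nzRingType) (I J : Type) (r : seq I) (s : seq J)
    (F : I -> A) (H : J -> A) (x : A) :
  (\sum_(i <- r) F i) * x * (\sum_(j <- s) H j) =
  \sum_(i <- r) \sum_(j <- s) F i * x * H j.
Proof.
rewrite mulr_suml mulr_suml; apply: eq_bigr => i _.
by rewrite mulr_sumr.
Qed.

Section TensorAlgebra.
Variables (R : comNzRingType) (M : lmodType R).

Local Notation free_alg := {malg R[{fmonom M}]}.

Definition letter (a : M) : free_alg := << fmu a >>.

Definition tensor_rel : free_alg -> Prop := linear_rel letter.

Lemma tensor_rel_proper : ~ gen_ideal tensor_rel 1.
Proof.
move=> /(_ (fun x : free_alg => x@_1%M = 0)) h; suff: (1 : R) = 0 by apply/eqP/oner_neq0.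
rewrite -(mcoeff1g_is_multiplicative {fmonom M} R).2; apply: h.
- split=> [|x y hx hy|u x v hx]; first by rewrite mcoeff0.
    by rewrite mcoeffB hx hy subrr.
  by rewrite !rmorphM /= hx mulr0 mul0r.
- move=> _ [c [a [b ->]]]; rewrite mcoeffB mcoeffD mcoeffZ /letter !mcoeffU1.
  by rewrite -!fdeg_eq0 !fdegU mulr0 addr0 subr0.
Qed.

Definition tensor_alg : Type := ring_quot tensor_rel_proper.
HB.instance Definition _ := GRing.Lalgebra.on tensor_alg.

Lemma free_alg_scaleAr (c : R) (x y : free_alg) : c *: (x * y) = x * (c *: y).
Proof.
have scE (z : free_alg) : c *: z = c%:MP * z by apply/esym/mul_malgC.
rewrite (scE (x * y)) (scE y) 2!mulrA.
suff -> : c%:MP * x = x * c%:MP :> free_alg by [].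
rewrite {1 2}[x]monalgE mulr_sumr mulr_suml; apply: eq_bigr => k _.
by rewrite 2!malgM_def 2!fgmulUU mulrC mul1m mulm1.
Qed.

Lemma tensor_alg_scaleAr (c : R) (x y : tensor_alg) :
  c *: (x * y) = x * (c *: y).
Proof.
elim/rq_ind: x => x; elim/rq_ind: y => y.
by rewrite -rmorphM -!linearZ /= -rmorphM free_alg_scaleAr.
Qed.

HB.instance Definition _ :=
  GRing.Lalgebra_isAlgebra.Build R tensor_alg tensor_alg_scaleAr.

Definition tpi : free_alg -> tensor_alg := rproj tensor_rel_proper.
HB.instance Definition _ := GRing.Linear.on tpi.
HB.instance Definition _ := GRing.RMorphism.on tpi.

Fact tin_key : unit. Proof. by []. Qed.
Definition tin : M -> tensor_alg := locked_with tin_key (fun a => tpi (letter a)).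

Lemma tinE a : tin a = tpi (letter a).
Proof. by rewrite /tin locked_withE. Qed.

Lemma tin_linear : linear tin.
Proof.
move=> c a b; rewrite !tinE -linearZ -raddfD; apply/rproj_eq.
by apply: gen_ideal_gen; exists c, a, b.
Qed.

HB.instance Definition _ := GRing.isLinear.Build R M tensor_alg _ tin tin_linear.

Definition tword (w : seq M) : tensor_alg := \prod_(a <- w) tin a.

Definition multilinear (V : lmodType R) (g : seq M -> V) : Prop :=
  forall w w' (c : R) (a b : M),
    g (w ++ (c *: a + b) :: w') = c *: g (w ++ a :: w') + g (w ++ b :: w').

Definition flift (V : lmodType R) (g : seq M -> V) (x : free_alg) : V :=
  \sum_(k <- msupp x) x@_k *: g (fmonom_val k).

(* The linear map sending a_1 (x) ... (x) a_n to g [:: a_1; ...; a_n]; only    *)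
(* meaningful for multilinear g, see [tlift_linear] and [tliftE].             *)
Definition tlift (V : lmodType R) (g : seq M -> V) (t : tensor_alg) : V :=
  flift g (rrepr (t : ring_quot tensor_rel_proper)).

Section Lift.
Variables (V : lmodType R) (g : seq M -> V).

Lemma fliftEw (E : {fset {fmonom M}}) x : (msupp x `<=` E)%fset ->
  flift g x = \sum_(k <- E) x@_k *: g (fmonom_val k).
Proof.
move=> le; rewrite [LHS](big_fset_incl _ le) => //= k _ /mcoeff_outdom ->.
by rewrite scale0r.
Qed.

Lemma flift_linear : linear (flift g).
Proof.
move=> c x y; pose E := (msupp x `|` msupp y `|` msupp (c *: x + y))%fset.
rewrite (@fliftEw E) ?fsubsetUr // (@fliftEw E x); last first.
  by rewrite /E -fsetUA fsubsetUl.
rewrite (@fliftEw E y); last by rewrite /E [(msupp x `|` _)%fset]fsetUC -fsetUA fsubsetUl.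
rewrite scaler_sumr -big_split /=; apply: eq_bigr => k _.
by rewrite mcoeffD mcoeffZ scalerDl scalerA.
Qed.

HB.instance Definition _ :=
  GRing.isLinear.Build R free_alg V _ (flift g) flift_linear.

Lemma fliftU k : flift g << k >> = g (fmonom_val k).
Proof. by rewrite (fliftEw msuppU_le) big_seq_fset1 mcoeffUU scale1r. Qed.

Lemma fliftB x y : flift g (x - y) = flift g x - flift g y.
Proof. exact: raddfB. Qed.

Lemma fliftM (u v : free_alg) z : flift g (u * letter z * v) =
  \sum_(k <- msupp u) \sum_(l <- msupp v)
    (u@_k * v@_l) *: g (fmonom_val k ++ z :: fmonom_val l).
Proof.
have := sandwich_sum (msupp u) (msupp v) (fun k => << u@_k *g k >>)
  (fun l => << v@_l *g l >>) (letter z).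
rewrite -!monalgE => ->; rewrite linear_sum; apply: eq_bigr => k _ /=.
rewrite linear_sum; apply: eq_bigr => l _ /=.
have -> : << u@_k *g k >> * letter z * << v@_l *g l >> =
    << u@_k * v@_l *g (k * fmu z * l)%M >> :> free_alg.
  by rewrite /letter !malgM_def !fgmulUU mulr1.
rewrite (fliftEw msuppU_le) big_seq_fset1 mcoeffUU.
by rewrite !fmM fmU -catA.
Qed.

Hypothesis gM : multilinear g.

Lemma flift_ideal x : gen_ideal tensor_rel x -> flift g x = 0.
Proof.
apply: (@linear_rel_ker R M free_alg letter V (flift g) _
  free_alg_scaleAr fliftM) => u v c a b.
rewrite scaler_sumr -big_split; apply: eq_bigr => k _ /=.
rewrite scaler_sumr -big_split; apply: eq_bigr => l _ /=.
by rewrite gM scalerDr !scalerA [c * _]mulrC.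
Qed.

Lemma tlift_pi x : tlift g (tpi x) = flift g x.
Proof.
by apply/eqP; rewrite -subr_eq0 -fliftB flift_ideal //; apply: rrepr_proj.
Qed.

Lemma tlift_linear : linear (tlift g).
Proof.
move=> c; elim/rq_ind=> x; elim/rq_ind=> y.
by rewrite -[rproj _ x]/(tpi x) -[rproj _ y]/(tpi y) -linearP !tlift_pi linearP.
Qed.

Lemma tliftE w : tlift g (tword w) = g w.
Proof.
have -> : tword w = tpi << FMonom w >>.
  elim: w => [|a w IH]; first by rewrite /tword big_nil -fmoneE -(rmorph1 tpi).
  rewrite /tword big_cons -/(tword w) {}IH tinE /letter -rmorphM; congr tpi.
  rewrite malgM_def fgmulUU mulr1; congr (<< _ >>).
  by apply/eqP; rewrite fmP fmM fmU.
by rewrite tlift_pi fliftU.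
Qed.

End Lift.

End TensorAlgebra.

Section IntegerValued.
Variable X : choiceType.

Local Notation polyQ := {malg rat[{cmonom X}]}.

Definition monom_eval (f : X -> int) (m : {cmonom X}) : rat :=
  \prod_(x <- finsupp m) (f x)%:~R ^+ m x.

Lemma monom_eval_mmorphism f : mmorphism (monom_eval f).
Proof.
have evalEw (m : {cmonom X}) (E : {fset X}) : (finsupp m `<=` E)%fset ->
    monom_eval f m = \prod_(x <- E) (f x)%:~R ^+ m x.
  move=> le; rewrite [LHS](big_fset_incl _ le) => //= x _.
  by rewrite memNfinsupp => /eqP ->.
split=> [m1 m2|]; last by rewrite /monom_eval mdom1 big_seq_fset0.
rewrite (evalEw m1 (finsupp m1 `|` finsupp m2)%fset) ?fsubsetUl //.
rewrite (evalEw m2 (finsupp m1 `|` finsupp m2)%fset) ?fsubsetUr //.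
rewrite /monom_eval mdomD -big_split; apply: eq_bigr => x _ /=.
by rewrite cmM exprD.
Qed.

HB.instance Definition _ f :=
  isMultiplicative.Build {cmonom X} rat (monom_eval f) (monom_eval_mmorphism f).

Definition peval (f : X -> int) : polyQ -> rat := mmap idfun (monom_eval f).

HB.instance Definition _ f := GRing.RMorphism.on (peval f).

Definition int_valued : polyQ -> bool :=
  fun q => `[< forall f : X -> int, peval f q \is a Num.int >].

Lemma int_valued_subring : subring_closed int_valued.
Proof.
split=> [|q r /asboolP hq /asboolP hr|q r /asboolP hq /asboolP hr];
  apply/asboolP => f.
- by rewrite rmorph1 rpred1.
- by rewrite rmorphB rpredB ?hq ?hr.
- by rewrite rmorphM rpredM ?hq ?hr.
Qed.

HB.instance Definition _ :=
  GRing.isSubringClosed.Build polyQ int_valued int_valued_subring.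

Record IntZ := MkIntZ { intz_val :> polyQ; _ : intz_val \in int_valued }.

HB.instance Definition _ := [isSub for intz_val].
HB.instance Definition _ := [Choice of IntZ by <:].
HB.instance Definition _ := [SubChoice_isSubComNzRing of IntZ by <:].

Definition intz_scale (n : int) (q : IntZ) : IntZ := q *~ n.

Lemma intz_scaleA a b q : intz_scale a (intz_scale b q) = intz_scale (a * b) q.
Proof. by rewrite /intz_scale -mulrzA mulrC. Qed.
Lemma intz_scale1 : left_id 1 intz_scale.
Proof. by move=> q; apply: mulr1z. Qed.
Lemma intz_scaleDr : right_distributive intz_scale +%R.
Proof. by move=> n q r; apply: mulrzDl. Qed.
Lemma intz_scaleDl q : {morph intz_scale^~ q : a b / a + b}.
Proof. by move=> a b; apply: mulrzDr. Qed.

HB.instance Definition _ := GRing.Zmodule_isLmodule.Build int IntZ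
  intz_scaleA intz_scale1 intz_scaleDr intz_scaleDl.

Lemma intz_scaleAl (n : int) (q r : IntZ) : n *: (q * r) = n *: q * r.
Proof. by rewrite -[LHS]/((q * r) *~ n) -[n *: q]/(q *~ n) mulrzAl. Qed.

HB.instance Definition _ := GRing.Lmodule_isLalgebra.Build int IntZ intz_scaleAl.
HB.instance Definition _ := GRing.Lalgebra_isComAlgebra.Build int IntZ.

Definition pvar (x : X) : polyQ := << ucm x >>.

Lemma peval_var f x : peval f (pvar x) = (f x)%:~R.
Proof.
rewrite /peval /pvar mmapU mul1r /monom_eval mdomU big_seq_fset1.
by rewrite cmUU expr1.
Qed.

Lemma pvar_int x : pvar x \in int_valued.
Proof. by apply/asboolP => f; rewrite peval_var intr_int. Qed.

Definition varZ (x : X) : IntZ := MkIntZ (pvar_int x).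

Definition pzeta (n : nat) (x : X) : polyQ :=
  n`!%:R^-1 *: \prod_(i < n) (pvar x - i%:R).

Lemma int_ffact_dvd (z : int) n :
  exists k : int, \prod_(i < n) (z - i%:R) = k * n`!%:R.
Proof.
case: z => k.
  exists 'C(k, n)%:R; rewrite -natrM bin_ffact ffact_prod natr_prod.
  have [le_nk|lt_kn] := leqP n k.
    by apply: eq_bigr => i _; rewrite natrB ?natz // ltnW // (leq_trans _ le_nk).
  rewrite (bigD1 (Ordinal lt_kn)) //= natz subrr mul0r.
  by rewrite (bigD1 (Ordinal lt_kn)) //= subnn mul0r.
exists ((-1) ^+ n * 'C(k + n, n)%:R).
rewrite -mulrA -natrM bin_ffact NegzE; elim: n => [|n IH].
  by rewrite big_ord0 ffactn0 mulr1.
rewrite big_ord_recr /= IH addnS ffactSS natrM exprS.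
have -> : - k.+1%:Z - n%:R = - (k + n).+1%:R :> int.
  by rewrite natz -opprD -PoszD addSn natz.
by move: ((-1) ^+ n) (_ ^_ n)%:R => x y; ring.
Qed.

Lemma pzeta_int n x : pzeta n x \in int_valued.
Proof.
apply/asboolP => f; rewrite /pzeta /peval mmapZ -/(peval f _) rmorph_prod /=.
have -> : \prod_(i < n) peval f (pvar x - i%:R) =
    (\prod_(i < n) (f x - i%:R))%:~R.
  rewrite rmorph_prod; apply: eq_bigr => i _.
  by rewrite rmorphB rmorph_nat /= peval_var rmorphB /= rmorph_nat.
have [k ->] := int_ffact_dvd (f x) n.
rewrite rmorphM /= rmorph_nat mulrCA mulVf ?mulr1 ?intr_int //.
by rewrite pnatr_eq0 -lt0n fact_gt0.
Qed.

Definition zeta (n : nat) (x : X) : IntZ := MkIntZ (pzeta_int n x).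

Lemma const_int (q : IntZ) : (q : polyQ)@_1%M \is a Num.int.
Proof.
case: q => q /= /asboolP /(_ (fun=> 0)); congr (_ \is a _).
rewrite /peval mmapE [RHS](_ : _ = \sum_(k <- msupp q) q@_k *+ (k == 1%M)).
  apply: eq_bigr => k _ /=; rewrite /monom_eval; have [->|] := eqVneq k 1%M.
    by rewrite mdom1 big_seq_fset0 mulr1.
  rewrite -mdeg_eq0 => hk; have /fset0Pn[x xk] : finsupp k != fset0.
    by apply: contraNneq hk => h; rewrite mdegE h big_seq_fset0.
  rewrite (big_fsetD1 x) //= expr0n; move: xk; rewrite -cmE_neq0 => /negPf ->.
  by rewrite mul0r mulr0 mulr0n.
rewrite {1}[q]monalgE raddf_sum; apply: eq_bigr => k _ /=.
by rewrite mcoeffU.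
Qed.

End IntegerValued.

Section IntegerValuedMod.
Variables (p : nat) (p_pr : prime p) (X : choiceType).

(* Dividing by p as well as by the zeta_n(x) is tensoring the quotient by the *)
(* latter with F_p.                                                           *)
Definition zeta_rel (q : IntZ X) : Prop :=
  q = p%:R \/ exists (x : X) (n : nat), (p <= n)%N /\ q = zeta n x.

Lemma zeta_rel_proper : ~ gen_ideal zeta_rel 1.
Proof.
pose ct (q : IntZ X) : rat := (intz_val q)@_1%M.
move=> /(_ (fun q => exists k : int, ct q = (k * p%:R)%:~R)) [].
- split=> [|q r [k hk] [l hl]|u q v [k hk]].
  + by exists 0; rewrite /ct /= mcoeff0 mul0r.
  + by exists (k - l); rewrite /ct /= mcoeffB -!/(ct _) hk hl mulrBl rmorphB.
  + have /intrP[a ha] := const_int u; have /intrP[b hb] := const_int v.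
    exists (a * k * b); rewrite /ct /= !rmorphM /= ha hb -/(ct q) hk.
    by rewrite -!intrM; congr (_%:~R); ring.
- move=> q [->|[x [n [le_pn ->]]]].
    exists 1; rewrite /ct mul1r rmorph_nat.
    have vE n : intz_val (n%:R : IntZ X) = n%:R :> {malg rat[{cmonom X}]}.
      exact: (rmorph_nat (\val : IntZ X -> {malg rat[{cmonom X}]}) n).
    rewrite vE.
    by rewrite rmorph_nat.
  exists 0; rewrite mul0r /ct /= /pzeta mcoeffZ rmorph_prod /=.
  have n_gt0 : (0 < n)%N by apply: leq_trans le_pn; apply: prime_gt0.
  rewrite (bigD1 (Ordinal n_gt0)) //= subr0 mcoeffU1.
  by rewrite cm1_eq1 mul0r mulr0.
move=> k; rewrite /ct /= mcoeff1 eqxx => /eqP.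
rewrite -(rmorph1 (intr : int -> rat)) eqr_int => /eqP.
move/(congr1 absz); rewrite abszM natz absz_nat => h.
have : (p %| 1)%N by rewrite -[1%N]/`|1|%N h dvdn_mull.
by rewrite dvdn1 => /eqP p1; move: (p_pr); rewrite p1.
Qed.

Lemma zeta_quot_pchar : p \in [pchar ring_quot zeta_rel_proper].
Proof.
rewrite inE p_pr /= -(rmorph_nat (rproj zeta_rel_proper)).
rewrite -(rmorph0 (rproj zeta_rel_proper)); apply/eqP/rproj_eq.
by rewrite subr0; apply: gen_ideal_gen; left.
Qed.

Definition IntFp : Type := pPrimeCharType zeta_quot_pchar.
HB.instance Definition _ := GRing.ComAlgebra.on IntFp.

Definition projFp (q : IntZ X) : IntFp := rproj zeta_rel_proper q.

End IntegerValuedMod.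

Definition lspan (R : pzRingType) (V : lmodType R) (P : V -> Prop) (v : V) : Prop :=
  exists s : seq (R * V),
    (forall cw, cw \in s -> P cw.2) /\ v = \sum_(cw <- s) cw.1 *: cw.2.

Section TensorCup.
Variables (R : comNzRingType) (M : lmodType R) (mu : M -> M -> M).
Local Notation T := (tensor_alg M).

Definition tgrade (n : nat) : T -> Prop :=
  lspan (fun t => exists w : n.-tuple M, t = tword w).

Definition tproj1 : T -> M := tlift (fun w => if w is [:: a] then a else 0).

(* The cup-one operations are total functions on the tensor algebra; only     *)
(* their restrictions to the components named in [tcup11E], [tcup21E] and     *)
(* [tcircE] are used.                                                         *)
Definition tcup11 (s t : T) : T := tin (mu (tproj1 s) (tproj1 t)).

Definition tcup21 (s t : T) : T :=
  let c := tproj1 t in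
  tlift (fun w => if w is [:: a; b]
                  then tin (mu a c) * tin b + tin a * tin (mu b c) else 0) s.

Definition tcirc (s t : T) : T :=
  tlift (fun w => if w is [:: a1; a2] then
    tlift (fun w' => if w' is [:: b1; b2]
                     then tin (mu a1 b1) * tin (mu a2 b2) else 0) t
    else 0) s.

Hypothesis mu_l : forall b, linear (mu^~ b).
Hypothesis mu_r : forall a, linear (mu a).

Lemma multilinear1 (V : lmodType R) (f : M -> V) :
  linear f -> multilinear (fun w : seq M => if w is [:: a] then f a else 0).
Proof.
move=> fL [|x [|y w]] [|x' w'] c a b //=; rewrite ?scaler0 ?addr0 //.
exact: fL.
Qed.

Lemma multilinear2 (V : lmodType R) (f : M -> M -> V) :
  (forall b, linear (f^~ b)) -> (forall a, linear (f a)) ->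
  multilinear (fun w : seq M => if w is [:: a; b] then f a b else 0).
Proof.
move=> fl fr [|x [|y [|z w]]] [|x' [|y' w']] c a b //=;
  rewrite ?scaler0 ?addr0 //; [exact: fl|exact: fr].
Qed.

Lemma tproj1_linear : linear tproj1.
Proof. exact/tlift_linear/(@multilinear1 _ id). Qed.

Lemma tproj1E a : tproj1 (tin a) = a.
Proof.
have -> : tin a = tword [:: a] by rewrite /tword big_seq1.
by rewrite /tproj1 tliftE //; apply: (@multilinear1 _ id).
Qed.

Lemma tword2 (a b : M) : tin a * tin b = tword [:: a; b].
Proof. by rewrite /tword big_cons big_seq1. Qed.

Lemma mul2_linearl (f : M -> M) (b : T) :
  linear f -> linear (fun a => tin (f a) * b).
Proof. by move=> fL c x y; rewrite fL linearP mulrDl scalerAl. Qed.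

Lemma mul2_linearr (f : M -> M) (b : T) :
  linear f -> linear (fun a => b * tin (f a)).
Proof. by move=> fL c x y; rewrite fL linearP mulrDr scalerAr. Qed.

Lemma tcup21_multilinear c :
  multilinear (fun w => if w is [:: a; b]
                        then tin (mu a c) * tin b + tin a * tin (mu b c) else 0).
Proof.
apply: (@multilinear2 _ (fun a b => tin (mu a c) * tin b + tin a * tin (mu b c))).
  move=> b k x y; rewrite [tin (mu _ c) * _](mul2_linearl _ (mu_l c)).
  by rewrite [tin _ * tin (mu b c)](@mul2_linearl id) // scalerDr addrACA.
move=> a k x y; rewrite [_ * tin (mu _ c)](mul2_linearr _ (mu_l c)).
by rewrite [_ * tin (k *: x + y)](@mul2_linearr id) // scalerDr addrACA.
Qed.

Lemma tcirc_multilinear_r a1 a2 :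
  multilinear (fun w => if w is [:: b1; b2]
                        then tin (mu a1 b1) * tin (mu a2 b2) else 0).
Proof.
apply: (@multilinear2 _ (fun b1 b2 => tin (mu a1 b1) * tin (mu a2 b2))) => b.
  exact/mul2_linearl/mu_r.
exact/mul2_linearr/mu_r.
Qed.

Lemma tlift_linear_fun (f g h : seq M -> T) (k : R) t :
  multilinear f -> multilinear g -> multilinear h ->
  (forall w, f w = k *: g w + h w) ->
  tlift f t = k *: tlift g t + tlift h t.
Proof.
move=> fM gM hM E; rewrite /tlift /flift scaler_sumr -big_split.
by apply: eq_bigr => i _ /=; rewrite E scalerDr !scalerA mulrC.
Qed.

Lemma tcirc_multilinear_l t :
  multilinear (fun w => if w is [:: a1; a2] then
    tlift (fun w' => if w' is [:: b1; b2]
                     then tin (mu a1 b1) * tin (mu a2 b2) else 0) t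
    else 0).
Proof.
apply: (@multilinear2 _ (fun a1 a2 => tlift _ t)) => b k x y /=;
  apply: tlift_linear_fun; try exact: tcirc_multilinear_r;
  move=> [|b1 [|b2 [|b3 w]]]; rewrite ?scaler0 ?addr0 //.
  exact: (mul2_linearl _ (mu_l b1)).
exact: (mul2_linearr _ (mu_l b2)).
Qed.

Lemma tcup11E a b : tcup11 (tin a) (tin b) = tin (mu a b).
Proof. by rewrite /tcup11 !tproj1E. Qed.

Lemma tcup21E a b c : tcup21 (tin a * tin b) (tin c) =
  tin (mu a c) * tin b + tin a * tin (mu b c).
Proof. by rewrite /tcup21 tproj1E tword2 tliftE //; apply: tcup21_multilinear. Qed.

Lemma tcircE a1 a2 b1 b2 : tcirc (tin a1 * tin a2) (tin b1 * tin b2) =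
  tin (mu a1 b1) * tin (mu a2 b2).
Proof.
rewrite /tcirc !tword2 tliftE; last exact: tcirc_multilinear_l.
by rewrite tliftE ?tword2 //; apply: tcirc_multilinear_r.
Qed.

Lemma tcup11_linearl t : linear (tcup11^~ t).
Proof. by move=> k x y; rewrite /tcup11 tproj1_linear mu_l linearP. Qed.

Lemma tcup11_linearr s : linear (tcup11 s).
Proof. by move=> k x y; rewrite /tcup11 tproj1_linear mu_r linearP. Qed.

Lemma tcup21_linearl t : linear (tcup21^~ t).
Proof. exact/tlift_linear/tcup21_multilinear. Qed.

Lemma tcup21_linearr s : linear (tcup21 s).
Proof.
move=> k x y; apply: tlift_linear_fun; try exact: tcup21_multilinear.
move=> [|a [|b [|? ?]]]; rewrite ?scaler0 ?addr0 // tproj1_linear !mu_r.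
by rewrite !linearP mulrDl mulrDr -scalerAl -scalerAr scalerDr addrACA.
Qed.

Lemma tcirc_linearl t : linear (tcirc^~ t).
Proof. exact/tlift_linear/tcirc_multilinear_l. Qed.

Lemma tcirc_linearr s : linear (tcirc s).
Proof.
move=> k x y; apply: tlift_linear_fun; try exact: tcirc_multilinear_l.
move=> [|a [|b [|? ?]]]; rewrite ?scaler0 ?addr0 //.
exact/tlift_linear/tcirc_multilinear_r.
Qed.

End TensorCup.

Section CupOneDga.
Variables (R : comNzRingType) (A : algType R).

(* Partial operations A^1 x A^1 -> A^1, D^2(A) x A^1 -> A^2 and               *)
(* D^2(A) x D^2(A) -> D^2(A), given as total functions of which only the      *)
(* values on these domains are ever constrained.                              *)
Record cup_one_ops := CupOneOps {
  cup11 : A -> A -> A;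
  cup21 : A -> A -> A;
  circ : A -> A -> A }.

Variables (gr : nat -> A -> Prop) (d : A -> A) (ops : cup_one_ops).

Definition submodule (V : lmodType R) (P : V -> Prop) : Prop :=
  P 0 /\ forall (c : R) u v, P u -> P v -> P (c *: u + v).

Definition bilinear_on (U V W : lmodType R)
    (P : U -> Prop) (Q : V -> Prop) (S : W -> Prop) (f : U -> V -> W) : Prop :=
  [/\ forall a b, P a -> Q b -> S (f a b),
      forall (c : R) a a' b, P a -> P a' -> Q b ->
        f (c *: a + a') b = c *: f a b + f a' b &
      forall (c : R) a b b', P a -> Q b -> Q b' ->
        f a (c *: b + b') = c *: f a b + f a b'].

Record graded_algebra : Prop := GradedAlgebra {
  gr_submodule : forall i, submodule (gr i);
  gr_one : gr 0%N 1;
  gr_mul : forall i j a b, gr i a -> gr j b -> gr (i + j)%N (a * b);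
  gr_span : forall a, exists (n : nat) (a_ : nat -> A),
    (forall i, gr i (a_ i)) /\ a = \sum_(i < n) a_ i;
  gr_direct : forall (n : nat) (a_ : nat -> A), (forall i, gr i (a_ i)) ->
    \sum_(i < n) a_ i = 0 -> forall i, (i < n)%N -> a_ i = 0 }.

Definition degree_one : Prop := forall i a, gr i a -> gr i.+1 (d a).

Definition graded_leibniz : Prop := forall i u v, gr i u ->
  d (u * v) = d u * v + (-1) ^+ i * u * d v.

Record dga : Prop := Dga {
  dga_graded : graded_algebra;
  dga_linear : linear d;
  dga_degree : degree_one;
  dga_square : forall a, d (d a) = 0;
  dga_leibniz : graded_leibniz }.

Definition D2 : A -> Prop :=
  lspan (fun t => exists a b, [/\ gr 1%N a, gr 1%N b & t = a * b]).

Definition cup1_d_formula (a b : A) : Prop :=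
  d (cup11 ops a b) =
    - (a * b) - b * a + cup21 ops (d a) b + cup21 ops (d b) a
    - circ ops (d a) (d b).

Record com_algebra_on (V : lmodType R) (S : V -> Prop)
    (mul : V -> V -> V) (one : V) : Prop := ComAlgebraOn {
  coa_submodule : submodule S;
  coa_bilinear : bilinear_on S S S mul;
  coa_one : S one;
  coa_mul1 : forall a, S a -> mul one a = a;
  coa_mulC : forall a b, S a -> S b -> mul a b = mul b a;
  coa_mulA : forall a b c, S a -> S b -> S c ->
    mul a (mul b c) = mul (mul a b) c }.

(* The algebra R (+) A^1, as a subset of R x A. *)
Definition unitized : (R^o * A)%type -> Prop := fun x => gr 1%N x.2.
Definition unitized_mul (x y : R^o * A) : R^o * A :=
  (x.1 * y.1, x.1 *: y.2 + y.1 *: x.2 + cup11 ops x.2 y.2).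
Definition unitized_one : (R^o * A)%type := (1, 0).

Record cup_one_dga : Prop := CupOneDga {
  cod_dga : dga;
  cod_cup11 : bilinear_on (gr 1%N) (gr 1%N) (gr 1%N) (cup11 ops);
  cod_cup21 : bilinear_on D2 (gr 1%N) (gr 2%N) (cup21 ops);
  cod_circ : bilinear_on D2 D2 D2 (circ ops);
  cod_unitized : com_algebra_on unitized unitized_mul unitized_one;
  cod_hirsch : forall a b c, gr 1%N a -> gr 1%N b -> gr 1%N c ->
    cup21 ops (a * b) c = a * cup11 ops b c + cup11 ops a c * b;
  cod_circE : forall u v w z, gr 1%N u -> gr 1%N v -> gr 1%N w -> gr 1%N z ->
    circ ops (u * v) (w * z) = cup11 ops u w * cup11 ops v z;
  cod_cup11_d : forall a c, gr 1%N a -> gr 0%N c ->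
    cup11 ops a (d c) = a * c - c * a;
  cod_cup1_d : forall a b, gr 1%N a -> gr 1%N b -> D2 (d a) -> D2 (d b) ->
    cup1_d_formula a b }.

End CupOneDga.

Inductive coef : Type := CoefZ | CoefFp (p : nat) of prime p.

Definition coef_ring (k : coef) : comNzRingType :=
  match k with CoefZ => int | CoefFp p _ => 'F_p end.

Definition falling (V : zmodType) (mul : V -> V -> V) (one a : V) (n : nat) : V :=
  \big[mul/one]_(i < n) (a - one *+ i).

Definition binomial_algebra_on (k : coef) (V : lmodType (coef_ring k))
    (S : V -> Prop) (mul : V -> V -> V) (one : V) : Prop :=
  com_algebra_on S mul one /\
  match k with
  | CoefZ =>
      (forall a n, S a -> (0 < n)%N -> a *+ n = 0 -> a = 0) /\
      (forall a n, S a -> (0 < n)%N ->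
        exists b, S b /\ b *+ n`! = falling mul one a n)
  | CoefFp p _ => forall a, S a -> falling mul one a p = 0
  end.

Record binomial_cup_one_dga (k : coef) (A : algType (coef_ring k))
    (gr : nat -> A -> Prop) (d : A -> A) (ops : cup_one_ops A) : Prop :=
  BinomialCupOneDga {
    bcd_cup_one : cup_one_dga gr d ops;
    bcd_deg0 : binomial_algebra_on (gr 0%N) *%R 1;
    bcd_unitized :
      binomial_algebra_on (unitized gr) (unitized_mul ops) (unitized_one A) }.

Definition IntR (k : coef) (X : choiceType) : comAlgType (coef_ring k) :=
  match k return comAlgType (coef_ring k) with
  | CoefZ => IntZ X
  | CoefFp p p_pr => IntFp p_pr X
  end.

Definition varR (k : coef) (X : choiceType) (x : X) : IntR k X :=
  match k return IntR k X with
  | CoefZ => varZ x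
  | CoefFp p p_pr => projFp p_pr (varZ x)
  end.

(* Over F_p: some integer-valued representative has zero constant term. *)
Definition zero_const (k : coef) (X : choiceType) : IntR k X -> Prop :=
  match k return IntR k X -> Prop with
  | CoefZ => fun q : IntZ X => (intz_val q)@_1%M = 0
  | CoefFp p p_pr => fun a : IntFp p_pr X =>
      exists2 q : IntZ X, (intz_val q)@_1%M = 0 & a = projFp p_pr q
  end.

Section AugmentationIdeal.
Variables (k : coef) (X : choiceType).

Definition zero_constb : IntR k X -> bool := fun a => `[< zero_const a >].

Lemma intz_const_scale (n : int) (q : IntZ X) :
  (intz_val q)@_1%M = 0 -> (intz_val (n *: q))@_1%M = 0.
Proof.
move=> hq; have -> : n *: q = n%:~R * q by rewrite -[LHS]/(q *~ n) mulrzl.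
by rewrite /= rmorphM /= hq mulr0.
Qed.

Lemma zero_const_submod : submod_closed zero_constb.
Proof.
rewrite /zero_constb; case: k => [|p p_pr] /=.
  split=> [|n q r /asboolP hq /asboolP hr]; apply/asboolP.
    by rewrite /= mcoeff0.
  by rewrite /= mcoeffD [X in X + _]intz_const_scale // hr addr0.
split=> [|n a b /asboolP[q hq ->] /asboolP[r hr ->]]; apply/asboolP.
  by exists 0; [rewrite /= mcoeff0 | rewrite /projFp rmorph0].
exists (n%:R * q + r).
  by rewrite /= mcoeffD rmorphM /= hq hr mulr0 addr0.
by rewrite /projFp rmorphD rmorphM rmorph_nat.
Qed.

HB.instance Definition _ :=
  GRing.isSubmodClosed.Build (coef_ring k) (IntR k X) zero_constb zero_const_submod.

Lemma zero_const_var x : varR k x \in zero_constb.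
Proof.
apply/asboolP; have hx : (pvar x)@_1%M = 0 by rewrite mcoeffU1 cm1_eq1.
by case: k => [|p p_pr] //=; exists (varZ x).
Qed.

Lemma zero_constM a b :
  a \in zero_constb -> b \in zero_constb -> a * b \in zero_constb.
Proof.
move=> /asboolP ha /asboolP hb; apply/asboolP; move: a b ha hb.
case: k => [|p p_pr] /=.
  by move=> q r hq hr; rewrite /= rmorphM /= hq mul0r.
move=> _ _ [q hq ->] [r hr ->]; exists (q * r); last by rewrite /projFp rmorphM.
by rewrite /= rmorphM /= hq mul0r.
Qed.

Record mIntR := MkMIntR { m_val :> IntR k X; _ : m_val \in zero_constb }.

HB.instance Definition _ := [isSub for m_val].
HB.instance Definition _ := [Choice of mIntR by <:].
HB.instance Definition _ := [SubChoice_isSubLmodule of mIntR by <:].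

Definition m_var (x : X) : mIntR := MkMIntR (zero_const_var x).

Definition m_mul (a b : mIntR) : mIntR :=
  MkMIntR (zero_constM (valP a) (valP b)).

Lemma m_mul_linearl b : linear (m_mul^~ b).
Proof.
by move=> c x y; apply: val_inj; rewrite /= mulrDl scalerAl.
Qed.

Lemma m_mul_linearr a : linear (m_mul a).
Proof.
by move=> c x y; apply: val_inj; rewrite /= mulrDr scalerAr.
Qed.

Definition freeT : algType (coef_ring k) := tensor_alg mIntR.

Definition freeT_grade : nat -> freeT -> Prop := @tgrade _ mIntR.

Definition freeT_var (x : X) : freeT := tin (m_var x).

Definition freeT_ops : cup_one_ops freeT :=
  CupOneOps (tcup11 m_mul) (tcup21 m_mul) (tcirc m_mul).

End AugmentationIdeal.

(* Main.v *)
Require Import Defs.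
From HB Require Import structures.
From mathcomp Require Import all_boot all_order all_algebra.
From mathcomp Require Import archimedean finfield finmap boolp xfinmap monalg ring.

Set Implicit Arguments.
Unset Strict Implicit.
Unset Printing Implicit Defensive.

Import GRing.Theory Num.Theory.
Local Open Scope ring_scope.

Local Notation "1" := (@mone _) : monom_scope.
Local Notation "x * y" := (mmul x y) : monom_scope.

(** Put [Delta a = a (x) 1 + 1 (x) a - d a] on the unitization [R (+) M] of
    [M = T^1].  The cup-one/d formula says exactly that [Delta] is multiplicative
    for the componentwise product on tensors, and [d (d a)] is the difference of
    the two iterated coproducts [(Delta (x) 1) Delta] and [(1 (x) Delta) Delta] at
    [a].  Both are multiplicative, so the [a] with [d (d a) = 0] form a
    subalgebra of [M].  Integer-valued polynomials have the basis of products of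
    the [zeta_n x], and [n! zeta_n x] is a polynomial in [x]: over [Z] one divides
    by [n!] because the third tensor power of [M] is torsion-free (its elements
    are separated by triples of Newton coefficients), and over [F_p] either [n!]
    is invertible or [zeta_n x] vanishes.  The Leibniz rule extends [d^2 = 0] from
    [M] to all tensors. *)

(** * Tensor algebras and componentwise products *)

(** The model for [Delta] is the group cochain identity [(d a)(g, h) = a(g) - a(g h) + a(h)]:
    [Delta a] plays the role of the function sending [(g, h)] to [a(g h)]. Pullback along a
    multiplication respects products of functions, and [d^2 = 0] corresponds to associativity.
    Expanding [d (d (a b))] directly would call for cup-one operations on tensors of degree three;
    the componentwise product [hadamard], defined in all degrees, takes their place. Two obstacles
    come from [M] having no unit. The tensors [a (x) 1] exist only over [R (+) M], hence a second
    tensor algebra [U] and an embedding [J] into it. And factors such as [x - i] of a falling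
    factorial do not lie in [M], hence closure arguments on [IntZ X] that are carried to [M] by
    [aug]. *)

Lemma mulrPl (R : pzRingType) (A : lalgType R) (c : R) (u v t : A) :
  (c *: u + v) * t = c *: (u * t) + v * t.
Proof. by rewrite mulrDl scalerAl. Qed.

Lemma mulrPr (R : comNzRingType) (A : algType R) (c : R) (u v t : A) :
  t * (c *: u + v) = c *: (t * u) + t * v.
Proof. by rewrite mulrDr scalerAr. Qed.

Section LinearMaps.
Variables (R : pzRingType) (U V : lmodType R) (f : U -> V).
Hypothesis fL : linear f.

(** Partially applied operations such as [hadamard^~ t] come only with a proof of linearity; packing
    that proof makes the morphism lemmas available for them. *)
Let F : {linear U -> V} := HB.pack f (GRing.isLinear.Build R U V _ f fL).

Lemma linear_map0 : f 0 = 0. Proof. exact: (raddf0 F). Qed.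
Lemma linear_mapD x y : f (x + y) = f x + f y. Proof. exact: (raddfD F). Qed.
Lemma linear_mapN x : f (- x) = - f x. Proof. exact: (raddfN F). Qed.
Lemma linear_mapB x y : f (x - y) = f x - f y. Proof. exact: (raddfB F). Qed.
Lemma linear_mapZ c x : f (c *: x) = c *: f x. Proof. exact: (linearZ_LR F). Qed.
Lemma linear_map_sum I (r : seq I) (P : pred I) (E : I -> U) :
  f (\sum_(i <- r | P i) E i) = \sum_(i <- r | P i) f (E i).
Proof. exact: (raddf_sum F). Qed.

End LinearMaps.

Section LinearSpan.
Variables (R : pzRingType) (V : lmodType R) (P : V -> Prop).

Lemma lspan_ind (Q : V -> Prop) : Q 0 ->
  (forall (c : R) u v, Q u -> Q v -> Q (c *: u + v)) ->
  (forall u, P u -> Q u) -> forall v, lspan P v -> Q v.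
Proof.
move=> Q0 QL PQ _ [s [sP ->]]; elim: s sP => [|cw s IH] sP; first by rewrite big_nil.
rewrite big_cons; apply: QL; first by apply/PQ/sP/mem_head.
by apply: IH => cw' h; apply: sP; rewrite inE h orbT.
Qed.

Lemma lspan0 : lspan P 0.
Proof. by exists [::]; split=> //; rewrite big_nil. Qed.

Lemma lspan_gen v : P v -> lspan P v.
Proof.
move=> Pv; exists [:: (1, v)]; split; last by rewrite big_seq1 scale1r.
by move=> cw; rewrite inE => /eqP ->.
Qed.

Lemma lspanP (c : R) u v : lspan P u -> lspan P v -> lspan P (c *: u + v).
Proof.
move=> [s [sP ->]] [s' [sP' ->]].
exists ([seq (c * cw.1, cw.2) | cw <- s] ++ s'); split.
  move=> cw; rewrite mem_cat => /orP[/mapP[cw' h ->]|]; last exact: sP'.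
  exact: (sP cw').
rewrite big_cat big_map scaler_sumr; congr (_ + _).
by apply: eq_bigr => i _; rewrite scalerA.
Qed.

Lemma linear_eq_lspan (W : lmodType R) (f g : V -> W) : linear f -> linear g ->
  (forall u, P u -> f u = g u) -> forall v, lspan P v -> f v = g v.
Proof.
move=> fL gL fg; apply: (@lspan_ind (fun v => f v = g v)) => [|c u v fu fv|//].
  by rewrite (linear_map0 fL) (linear_map0 gL).
by rewrite fL gL fu fv.
Qed.

End LinearSpan.

Lemma malg_linear_sum (K : choiceType) (R : nzRingType) (V : lmodType R)
    (f : {linear {malg R[K]} -> V}) (x : {malg R[K]}) :
  f x = \sum_(k <- msupp x) x@_k *: f << k >>.
Proof.
rewrite {1}[x]monalgE raddf_sum; apply: eq_bigr => k _ /=.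
rewrite -linearZ_LR; congr (f _); apply/malgP => l.
by rewrite mcoeffZ !mcoeffU; case: (k == l); [apply/esym/mulr1|apply/esym/mulr0].
Qed.

(* An abstract carrier: unification in [tensor_alg M] unfolds the operations of *)
(* the quotient ring and does not terminate in practice.                        *)
Record tensor_model (R : comNzRingType) (M : lmodType R) := TensorModel {
  tm_alg :> algType R;
  tm_in : {linear M -> tm_alg};
  tm_lift : forall V : lmodType R, (seq M -> V) -> tm_alg -> V;
  tm_lift_linear : forall (V : lmodType R) (g : seq M -> V),
    multilinear g -> linear (tm_lift g);
  tm_lift_prod : forall (V : lmodType R) (g : seq M -> V), multilinear g ->
    forall w, tm_lift g (\prod_(a <- w) tm_in a) = g w;
  tm_ind : forall Q : tm_alg -> Prop, Q 0 ->
    (forall (c : R) u v, Q u -> Q v -> Q (c *: u + v)) ->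
    (forall w, Q (\prod_(a <- w) tm_in a)) -> forall t, Q t }.

Section TensorAlgModel.
Variables (R : comNzRingType) (M : lmodType R).
Local Notation T := (tensor_alg M).

Lemma tword_nil : tword [::] = 1 :> T.
Proof. by rewrite /tword big_nil. Qed.

Lemma tword_cons a (w : seq M) : tword (a :: w) = tin a * tword w.
Proof. by rewrite /tword big_cons. Qed.

Lemma tpi_word (k : {fmonom M}) : tpi << k >> = tword (fmonom_val k).
Proof.
have -> : k = FMonom (fmonom_val k) by rewrite fmK.
rewrite /=; elim: (fmonom_val k) => [|a w IH].
  by rewrite tword_nil -fmoneE -(rmorph1 (@tpi R M)).
rewrite tword_cons -{}IH tinE /letter -rmorphM; congr tpi.
rewrite malgM_def fgmulUU mulr1; congr (<< _ >>).
by apply/eqP; rewrite fmP fmM fmU.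
Qed.

Lemma tensor_ind (Q : T -> Prop) : Q 0 ->
  (forall (c : R) u v, Q u -> Q v -> Q (c *: u + v)) ->
  (forall w, Q (tword w)) -> forall t, Q t.
Proof.
move=> Q0 QL Qw; elim/rq_ind=> x; rewrite -[rproj _ x]/(tpi x).
rewrite (malg_linear_sum (@tpi R M)); elim: (enum_fset _) => [|k s IH].
  by rewrite big_nil.
rewrite big_cons -[X in _ *: X + _]/(tpi << k >>) tpi_word.
exact: QL.
Qed.

Definition tensor_alg_model : tensor_model M :=
  TensorModel (@tlift_linear R M) (@tliftE R M) tensor_ind.

End TensorAlgModel.

Section TensorWords.
Variables (R : comNzRingType) (M : lmodType R).
Variable T : tensor_model M.
Local Notation tin := (tm_in T).

Definition word (w : seq M) : T := \prod_(a <- w) tin a.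

Definition grade (n : nat) : T -> Prop :=
  lspan (fun t => exists w : n.-tuple M, t = word w).

Lemma word2 a b : tin a * tin b = word [:: a; b].
Proof. by rewrite /word big_cons big_seq1. Qed.

Lemma lift_word (V : lmodType R) (g : seq M -> V) : multilinear g ->
  forall w, tm_lift g (word w) = g w.
Proof. exact: tm_lift_prod. Qed.

Lemma word_cat (w w' : seq M) : word (w ++ w') = word w * word w'.
Proof. by rewrite /word big_cat. Qed.

Lemma word_cons a (w : seq M) : word (a :: w) = tin a * word w.
Proof. by rewrite /word big_cons. Qed.

Lemma word_nil : word [::] = 1.
Proof. by rewrite /word big_nil. Qed.

Lemma word1 a : word [:: a] = tin a.
Proof. by rewrite /word big_seq1. Qed.

Lemma tensor_eq (V : lmodType R) (f g : T -> V) : linear f -> linear g ->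
  (forall w, f (word w) = g (word w)) -> forall t, f t = g t.
Proof.
move=> fL gL fg; apply: tm_ind => [|c u v fu fv|//].
  by rewrite (linear_map0 fL) (linear_map0 gL).
by rewrite fL gL fu fv.
Qed.

Lemma grade_eq n (V : lmodType R) (f g : T -> V) : linear f -> linear g ->
  (forall w, size w = n -> f (word w) = g (word w)) ->
  forall t, grade n t -> f t = g t.
Proof.
by move=> fL gL fg; apply: linear_eq_lspan => // _ [w ->]; rewrite fg ?size_tuple.
Qed.

Lemma grade_ind n (Q : T -> Prop) : Q 0 ->
  (forall (c : R) u v, Q u -> Q v -> Q (c *: u + v)) ->
  (forall w, size w = n -> Q (word w)) -> forall t, grade n t -> Q t.
Proof.
move=> Q0 QL Qw; apply: lspan_ind => // _ [w ->].
by apply: Qw; rewrite size_tuple.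
Qed.

Lemma grade_word (w : seq M) : grade (size w) (word w).
Proof. by apply: lspan_gen; exists (in_tuple w). Qed.

Lemma grade_submodule n : submodule (grade n).
Proof. by split=> [|c u v]; [apply: lspan0|apply: lspanP]. Qed.

Lemma gradeD n (s t : T) : grade n s -> grade n t -> grade n (s + t).
Proof. by move=> hs ht; rewrite -[s]scale1r; apply: lspanP. Qed.

Lemma gradeZ n c (s : T) : grade n s -> grade n (c *: s).
Proof. by move=> hs; rewrite -[_ *: _]addr0; apply: lspanP => //; apply: lspan0. Qed.

Lemma gradeB n (s t : T) : grade n s -> grade n t -> grade n (s - t).
Proof. by move=> hs ht; rewrite -scaleN1r addrC; apply: lspanP. Qed.

Lemma grade_tin a : grade 1 (tin a : T).
Proof. by rewrite -word1; apply: (grade_word [:: a]). Qed.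

Lemma gradeM i j (s t : T) : grade i s -> grade j t -> grade (i + j) (s * t).
Proof.
move=> hs ht; move: s hs; apply: grade_ind => [|c u v hu hv|w <-].
- by rewrite mul0r; apply: lspan0.
- by rewrite mulrPl; apply: lspanP.
move: t ht; apply: grade_ind => [|c u v hu hv|w' <-].
- by rewrite mulr0; apply: lspan0.
- by rewrite mulrPr; apply: lspanP.
by rewrite -word_cat -size_cat; apply: grade_word.
Qed.

Lemma grade0P (t : T) : grade 0 t -> exists c : R, t = c *: 1.
Proof.
move: t; apply: grade_ind => [|c _ _ [a ->] [b ->]|[] // _].
- by exists 0; rewrite scale0r.
- by exists (c * a + b); rewrite scalerDl scalerA.
- by exists 1; rewrite scale1r word_nil.
Qed.

Lemma grade1P (t : T) : grade 1 t -> exists a : M, t = tin a.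
Proof.
move: t; apply: grade_ind => [|c _ _ [a ->] [b ->]|[|a []] // _].
- by exists 0; rewrite raddf0.
- by exists (c *: a + b); rewrite linearP.
- by exists a; rewrite word1.
Qed.

(** Serves to prove linearity in a parameter of the lifted function rather than in the tensor: both
    sides are linear in [t], so words suffice. *)
Lemma lift_linear_fun (V : lmodType R) (f g h : seq M -> V) (k : R) (t : T) :
  multilinear f -> multilinear g -> multilinear h ->
  (forall w, f w = k *: g w + h w) ->
  tm_lift f t = k *: tm_lift g t + tm_lift h t.
Proof.
move=> fM gM hM E; move: t; apply: tensor_eq (tm_lift_linear fM) _ _ => [c x y|w].
  rewrite !tm_lift_linear // !scalerDr !scalerA [k * c]mulrC.
  by rewrite [LHS]addrACA.
by rewrite !lift_word.
Qed.

Definition tcomp (n : nat) : T -> T :=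
  tm_lift (fun w => if size w == n then word w else 0).

Lemma word_multilinear : multilinear (word).
Proof.
move=> w w' c a b; rewrite !word_cat !word_cons linearP.
by rewrite mulrPl mulrPr.
Qed.

Lemma tcomp_multilinear n :
  multilinear (fun w : seq M => if size w == n then word w else 0 : T).
Proof.
move=> w w' c a b; rewrite !size_cat /=.
by case: ifP => _; [apply: word_multilinear|rewrite scaler0 addr0].
Qed.

Lemma tcomp_linear n : linear (tcomp n).
Proof. exact/tm_lift_linear/tcomp_multilinear. Qed.

Lemma tcomp_word n w : tcomp n (word w) = if size w == n then word w else 0.
Proof. by rewrite /tcomp lift_word //; apply: tcomp_multilinear. Qed.

Lemma tcomp_grade n m (t : T) : grade m t -> tcomp n t = if m == n then t else 0.
Proof.
move: t; apply: (@grade_eq m _ _ (fun t => if m == n then t else 0)) => [||w <-].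
- exact: tcomp_linear.
- by move=> c x y; case: ifP; rewrite ?scaler0 ?addr0.
- exact: tcomp_word.
Qed.

Lemma tensor_graded : graded_algebra (grade).
Proof.
split; first exact: grade_submodule.
- by rewrite -word_nil; apply: (grade_word [::]).
- exact: gradeM.
- move=> t.
  (* The claim covers every [m >= n], so that two summands can be given a common bound. *)
  have [n hn] : exists n, forall m, (n <= m)%N -> t = \sum_(i < m) tcomp i t.
    move: t; apply: tm_ind => [|c u v [n hn] [m hm]|w].
    + exists 0%N => m _; rewrite big1 // => i _.
      exact/linear_map0/tcomp_linear.
    + exists (maxn n m) => l; rewrite geq_max => /andP[nl ml].
      rewrite {1}(hn l nl) {1}(hm l ml) scaler_sumr -big_split /=.
      by apply: eq_bigr => i _; rewrite tcomp_linear.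
    exists (size w).+1 => m wm; rewrite (bigD1 (Ordinal wm)) //= tcomp_word eqxx.
    rewrite [X in _ + X]big1 ?addr0 // => i /negP wi.
    rewrite tcomp_word; case: eqP => // e.
    by case: wi; apply/eqP/val_inj.
  exists n, (fun i => tcomp i t); split; last exact: hn.
  move=> i; move: t {hn}; apply: tm_ind => [|c u v hu hv|w].
  + by rewrite (linear_map0 (@tcomp_linear i)); apply: lspan0.
  + by rewrite tcomp_linear; apply: lspanP.
  + by rewrite tcomp_word; case: eqP => [<-|_]; [apply: grade_word|apply: lspan0].
- move=> n a ha a0 i lt_in.
  have := congr1 (tcomp i) a0.
  rewrite (linear_map0 (@tcomp_linear i)) (linear_map_sum (@tcomp_linear i)).
  rewrite (bigD1 (Ordinal lt_in)) //= (tcomp_grade i (ha i)) eqxx big1 ?addr0 //.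
  move=> j /negP ji; rewrite (tcomp_grade i (ha j)); case: eqP => // e.
  by case: ji; apply/eqP/val_inj.
Qed.

(** Turns statements about [D2] into inductions over words of length two. *)
Lemma tensor_D2 (t : T) : D2 (grade) t <-> grade 2 t.
Proof.
split; last first.
  move: t; apply: lspan_ind => [|c u v|_ [[[|a [|b []]] // sw] ->]].
  + exact: lspan0.
  + exact: lspanP.
  apply: lspan_gen; exists (tin a), (tin b).
  by split; [apply: grade_tin|apply: grade_tin|rewrite word2].
move: t; apply: lspan_ind => [|c u v|_ [a [b [ha hb ->]]]].
- exact: lspan0.
- exact: lspanP.
- exact: (gradeM ha hb).
Qed.

End TensorWords.

Section TensorMap.
Variables (R : comNzRingType) (M : lmodType R) (B : algType R) (f : M -> B).
Hypothesis fL : linear f.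
Variable T : tensor_model M.
Local Notation tin := (tm_in T).
Local Notation word := (word T).

Definition tmorph : T -> B := tm_lift (fun w => \prod_(a <- w) f a).

Lemma tmorph_multilinear : multilinear (fun w : seq M => \prod_(a <- w) f a).
Proof.
move=> w w' c a b; rewrite !big_cat !big_cons /= fL.
by rewrite mulrPl mulrPr.
Qed.

Lemma tmorph_linear : linear tmorph.
Proof. exact/tm_lift_linear/tmorph_multilinear. Qed.

Lemma tmorph_word w : tmorph (word w) = \prod_(a <- w) f a.
Proof. by rewrite /tmorph lift_word //; apply: tmorph_multilinear. Qed.

Lemma tmorph_tin a : tmorph (tin a) = f a.
Proof. by rewrite -word1 tmorph_word big_seq1. Qed.

Lemma tmorphM s t : tmorph (s * t) = tmorph s * tmorph t.
Proof.
move: s; apply: (@tensor_eq _ _ _ _ (fun s => tmorph (s * t))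
  (fun s => tmorph s * tmorph t)).
- by move=> c x y; rewrite mulrPl tmorph_linear.
- by move=> c x y; rewrite tmorph_linear mulrPl.
move=> w; move: t; apply: (@tensor_eq _ _ _ _ (fun t => tmorph (_ * t))
  (fun t => _ * tmorph t)).
- by move=> c x y; rewrite mulrPr tmorph_linear.
- by move=> c x y; rewrite tmorph_linear mulrPr.
by move=> w'; rewrite -word_cat !tmorph_word big_cat.
Qed.

End TensorMap.

Arguments tmorph {R M B} f {T} _.

(** * The componentwise product of tensors *)

Section Hadamard.
Variables (R : comNzRingType) (N : lmodType R) (mul : N -> N -> N).
Hypothesis mulC : commutative mul.
Hypothesis mul_r : forall a, linear (mul a).
Variable T : tensor_model N.
Local Notation tin := (tm_in T).
Local Notation word := (word T).
Local Notation grade := (@grade R N T).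

(** Words of different lengths multiply to 0, which makes the product total and still multilinear in
    each word. On words of length two it is the formula for [circ]. *)
Fixpoint hadamard_word (w w' : seq N) : T :=
  match w, w' with
  | [::], [::] => 1
  | a :: u, b :: u' => tin (mul a b) * hadamard_word u u'
  | _, _ => 0
  end.

Lemma hadamard_wordC w w' : hadamard_word w w' = hadamard_word w' w.
Proof. by elim: w w' => [|a w IH] [|b w'] //=; rewrite IH mulC. Qed.

Lemma hadamard_word_multilinear w : multilinear (hadamard_word w).
Proof.
elim: w => [|a w IH] [|z u] w' c x y /=; rewrite ?scaler0 ?addr0 //.
  by rewrite mul_r linearP mulrPl.
by rewrite IH mulrPr.
Qed.

Definition hadamard (s t : T) : T := tm_lift (fun w => tm_lift (hadamard_word w) t) s.

(** Commutativity of [mul] lets the two words be exchanged, which reduces multilinearity in the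
    first word to that in the second. *)
Lemma hadamard_multilinear (t : T) : multilinear (fun w => tm_lift (hadamard_word w) t).
Proof.
move=> w w' c a b; apply: lift_linear_fun; try exact: hadamard_word_multilinear.
by move=> v; rewrite ![hadamard_word _ v]hadamard_wordC hadamard_word_multilinear.
Qed.

Lemma hadamard_linearl t : linear (hadamard^~ t).
Proof. exact/tm_lift_linear/hadamard_multilinear. Qed.

Lemma hadamard_linearr s : linear (hadamard s).
Proof.
move=> c x y; apply: lift_linear_fun; try exact: hadamard_multilinear.
by move=> w; apply/tm_lift_linear/hadamard_word_multilinear.
Qed.

Lemma hadamardE w w' : hadamard (word w) (word w') = hadamard_word w w'.
Proof.
rewrite /hadamard lift_word; last exact: hadamard_multilinear.
by rewrite lift_word //; apply: hadamard_word_multilinear.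
Qed.

Lemma hadamard_tin a b : hadamard (tin a) (tin b) = tin (mul a b).
Proof. by rewrite -!word1 hadamardE /= mulr1 word1. Qed.

(** The common degree [n] aligns the letters of [s] with those of [s'], so no letter is paired
    across the cut. The tails [t] and [t'] may be of any degrees: tails of different lengths give 0
    on both sides. *)
Lemma hadamardM n s s' t t' : grade n s -> grade n s' ->
  hadamard (s * t) (s' * t') = hadamard s s' * hadamard t t'.
Proof.
move=> hs hs'; move: s hs.
apply: (@grade_eq _ _ _ _ _ (fun s => hadamard (s * t) (s' * t'))
  (fun s => hadamard s s' * hadamard t t')).
- by move=> c x y; rewrite mulrPl hadamard_linearl.
- by move=> c x y; rewrite hadamard_linearl mulrPl.
move=> w wn; move: s' hs'.
apply: (@grade_eq _ _ _ _ _ (fun s' => hadamard (_ * t) (s' * t'))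
  (fun s' => hadamard _ s' * hadamard t t')).
- by move=> c x y; rewrite mulrPl hadamard_linearr.
- by move=> c x y; rewrite hadamard_linearr mulrPl.
move=> w'; rewrite -wn => {wn} ww'; move: t.
apply: (@tensor_eq _ _ _ _ (fun t => hadamard (_ * t) (_ * t'))
  (fun t => hadamard _ _ * hadamard t t')).
- by move=> c x y; rewrite mulrPr hadamard_linearl.
- by move=> c x y; rewrite hadamard_linearl mulrPr.
move=> u; move: t'.
apply: (@tensor_eq _ _ _ _ (fun t' => hadamard (_ * _) (_ * t'))
  (fun t' => hadamard _ _ * hadamard _ t')).
- by move=> c x y; rewrite mulrPr hadamard_linearr.
- by move=> c x y; rewrite hadamard_linearr mulrPr.
move=> u'; rewrite -!word_cat !hadamardE.
elim: w w' ww' => [|a w IH] [|b w'] //=; first by rewrite mul1r.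
by case=> /IH ->; rewrite mulrA.
Qed.

Lemma hadamardC s t : hadamard s t = hadamard t s.
Proof.
move: s; apply: (@tensor_eq _ _ _ _ _ (hadamard t)) => [||w].
- exact: hadamard_linearl.
- exact: hadamard_linearr.
move: t; apply: (@tensor_eq _ _ _ _ _ (hadamard^~ _)) => [||w'].
- exact: hadamard_linearr.
- exact: hadamard_linearl.
by rewrite !hadamardE hadamard_wordC.
Qed.

Lemma hadamard2 a b a' b' :
  hadamard (tin a * tin b) (tin a' * tin b') = tin (mul a a') * tin (mul b b').
Proof. by rewrite !word2 hadamardE /= mulr1 word2. Qed.

Lemma hadamard_id2 e : (forall a, mul e a = a) ->
  forall t, grade 2 t -> hadamard (tin e * tin e) t = t.
Proof.
move=> mul1; apply: (@grade_eq _ _ _ _ _ _ id) => [||[|a [|b []]] // _].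
- exact: hadamard_linearr.
- by move=> c x y.
by rewrite -word2 hadamard2 !mul1.
Qed.

End Hadamard.

(** * The coproduct of a cup-one differential *)

Section CupOneSpec.
Variables (R : comNzRingType) (M : lmodType R) (T : tensor_model M).
Variable mu : M -> M -> M.
Local Notation tin := (tm_in T).

(** Values on generators together with linearity in each argument determine the operations in the
    degrees concerned, and the arguments below work from this data alone. *)
Record cup_one_spec (ops : cup_one_ops T) : Prop := CupOneSpec {
  spec11 : forall a b, cup11 ops (tin a) (tin b) = tin (mu a b);
  spec21 : forall a b c, cup21 ops (tin a * tin b) (tin c) =
    tin (mu a c) * tin b + tin a * tin (mu b c);
  spec_circ : forall a b a' b', circ ops (tin a * tin b) (tin a' * tin b') =
    tin (mu a a') * tin (mu b b');
  spec11_linearl : forall t, linear ((cup11 ops)^~ t);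
  spec11_linearr : forall s, linear (cup11 ops s);
  spec21_linearl : forall t, linear ((cup21 ops)^~ t);
  spec21_linearr : forall s, linear (cup21 ops s);
  spec_circ_linearl : forall t, linear ((circ ops)^~ t);
  spec_circ_linearr : forall s, linear (circ ops s) }.

End CupOneSpec.

Section Coproduct.
Variables (R : comNzRingType) (M : lmodType R) (mu : M -> M -> M).
Local Notation N := (R^o * M)%type.
Variables (T : tensor_model M) (U : tensor_model N) (ops : cup_one_ops T).
Hypotheses (muC : commutative mu) (mu_r : forall a, linear (mu a)).
Hypothesis opsP : cup_one_spec mu ops.
Variable d : {linear T -> T}.
Hypotheses (d_degree : degree_one (@grade R M T) d)
  (d_cup1 : forall a b, cup1_d_formula d ops (tm_in T a) (tm_in T b))
  (d_leibniz : graded_leibniz (@grade R M T) d).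

Definition unit_mul (x y : N) : N :=
  (x.1 * y.1, x.1 *: y.2 + y.1 *: x.2 + mu x.2 y.2).

Lemma unit_mulC : commutative unit_mul.
Proof.
move=> [r a] [s b]; rewrite /unit_mul /= muC mulrC.
by congr (_, _ + _); rewrite addrC.
Qed.

Lemma unit_mul_linear x : linear (unit_mul x).
Proof.
case: x => r a c [s b] [t b']; rewrite /unit_mul /=; congr (_, _).
  by rewrite mulrDr mulrCA.
rewrite -[RHS]/(c *: (r *: b + s *: a + mu a b) + (r *: b' + t *: a + mu a b')).
rewrite mu_r !scalerDr scalerDl !scalerA [r * c]mulrC.
by rewrite !addrA [LHS](ACl (1*3*5*2*4*6))%AC.
Qed.

(** The unit of [R (+) M] taken as a letter: [e] has degree one in [U] and differs from [1 : U].
    Thus [inj a * e] is the degree-two tensor [a (x) 1]. *)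
Let e : U := tm_in U (1, 0).
Let inj (a : M) : U := tm_in U (0, a).

Let inj_linear : linear inj.
Proof.
move=> c a b; rewrite /inj -linearP; congr (tm_in U (_, _)).
by rewrite /= scaler0 addr0.
Qed.

Lemma unit_mul1 x : unit_mul (1, 0) x = x.
Proof.
case: x => r a; rewrite /unit_mul /= mul1r scale1r scaler0 addr0.
by rewrite muC (linear_map0 (mu_r a)) addr0.
Qed.

Lemma unit_mul_inj a b : unit_mul (0, a) (0, b) = (0, mu a b).
Proof. by rewrite /unit_mul /= mul0r !scale0r !add0r. Qed.

Let J : T -> U := tmorph inj.
Let J_linear : linear J. Proof. exact: tmorph_linear. Qed.
Let JM s t : J (s * t) = J s * J t. Proof. exact: tmorphM. Qed.
Let J_in a : J (tm_in T a) = inj a. Proof. exact: tmorph_tin. Qed.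

Let J_grade n t : grade n t -> grade n (J t).
Proof.
move: t; apply: grade_ind => [|c u v hu hv|w <-].
- by rewrite (linear_map0 J_linear); apply: lspan0.
- by rewrite J_linear; apply: lspanP.
rewrite /J tmorph_word //.
have -> : \prod_(a <- w) inj a = word U [seq (0, a) | a <- w].
  by rewrite /word big_map.
by rewrite -(size_map (fun a => (0 : R^o, a))); apply: grade_word.
Qed.

(** The projection of [N] onto [M] is linear, though not multiplicative for [unit_mul]; linearity is
    enough for it to induce an algebra map from [U] back to [T], and this map is a left inverse of
    [J]. *)
Let J_inj : injective J.
Proof.
have sL : linear (fun x : N => tm_in T x.2) by move=> c x y; rewrite -linearP.
apply: (can_inj (g := tmorph (fun x : N => tm_in T x.2))).
apply: (@tensor_eq _ _ _ _ (fun t => tmorph _ (J t)) id) => [c x y|//|w].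
  by rewrite J_linear (tmorph_linear sL).
elim: w => [|a w IH]; rewrite ?word_nil ?word_cons.
  rewrite -[1 in LHS](word_nil T) /J tmorph_word // big_nil.
  by rewrite -(word_nil U) tmorph_word // big_nil.
by rewrite JM J_in (tmorphM sL) IH /inj tmorph_tin.
Qed.

Let had := hadamard (T := U) unit_mul.
Let had_l t : linear (had^~ t).
Proof. exact: (hadamard_linearl unit_mulC unit_mul_linear). Qed.
Let had_r s : linear (had s).
Proof. exact: (hadamard_linearr unit_mulC unit_mul_linear). Qed.
Let had2 a b a' b' : had (tm_in U a * tm_in U b) (tm_in U a' * tm_in U b') =
  tm_in U (unit_mul a a') * tm_in U (unit_mul b b').
Proof. exact: (hadamard2 unit_mulC unit_mul_linear). Qed.

Let prim (a : M) : U := inj a * e + e * inj a.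
Let red (a : M) : U := prim a - J (d (tm_in T a)).

Let prim_linear : linear prim.
Proof.
by move=> c a b; rewrite /prim inj_linear mulrPl mulrPr scalerDr addrACA.
Qed.

Let red_linear : linear red.
Proof.
move=> c a b; rewrite /red prim_linear linearP [d _]linearP J_linear.
by rewrite scalerBr opprD addrACA.
Qed.

(** [Delta] on all of [R (+) M], with the unit group-like: 1 goes to [1 (x) 1]. *)
Let coprod (x : N) : U := x.1 *: (e * e) + red x.2.

Let coprod_linear : linear coprod.
Proof.
move=> c [r a] [s b].
rewrite -[LHS]/((c * r + s) *: (e * e) + red (c *: a + b)) red_linear /coprod /=.
by rewrite scalerDl [c *: (_ + red a)]scalerDr scalerA [LHS]addrACA.
Qed.

Let in2_grade x y : grade 2 (tm_in U x * tm_in U y).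
Proof. exact: (gradeM (grade_tin _ _) (grade_tin _ _)). Qed.

Let dgrade a : grade 2 (d (tm_in T a)).
Proof. exact/d_degree/grade_tin. Qed.

Let red_grade a : grade 2 (red a).
Proof.
apply: gradeB; last exact/J_grade/dgrade.
by apply: gradeD; apply: in2_grade.
Qed.

Let coprod_grade x : grade 2 (coprod x).
Proof. by apply: gradeD; [apply/gradeZ/in2_grade|apply: red_grade]. Qed.

(** The mixed terms [a (x) b] and [b (x) a] are, up to sign, the first two terms of the cup-one/d
    formula. Its [cup21] terms come from [had_J_prim], its [circ] term from [had_J]. *)
Let had_prim a b :
  had (prim a) (prim b) = prim (mu a b) + inj a * inj b + inj b * inj a.
Proof.
rewrite /prim (linear_mapD (had_l _)) !(linear_mapD (had_r _)) !had2.
rewrite unit_mul_inj unit_mul1 !unit_mul1 ![unit_mul _ (1, 0)]unit_mulC !unit_mul1.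
rewrite -/e -!/(inj _) !addrA.
by rewrite (ACl (1*4*2*3))%AC.
Qed.

Let had_J_prim b t : grade 2 t -> had (J t) (prim b) = J (cup21 ops t (tm_in T b)).
Proof.
move: t; apply: grade_eq => [c x y|c x y|[|x [|y []]] // _].
- by rewrite J_linear had_l.
- by rewrite (spec21_linearl opsP) J_linear.
rewrite -word2 (spec21 opsP) JM !J_in (linear_mapD J_linear) !JM !J_in.
rewrite /prim (linear_mapD (had_r _)) !had2 !unit_mul_inj.
by rewrite ![unit_mul _ (1, 0)]unit_mulC !unit_mul1.
Qed.

Let had_J s t : grade 2 s -> grade 2 t -> had (J s) (J t) = J (circ ops s t).
Proof.
move=> hs ht; move: s hs; apply: grade_eq => [c x y|c x y|[|x [|y []]] // _].
- by rewrite J_linear had_l.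
- by rewrite (spec_circ_linearl opsP) J_linear.
move: t ht; apply: grade_eq => [c u v|c u v|[|x' [|y' []]] // _].
- by rewrite J_linear had_r.
- by rewrite (spec_circ_linearr opsP) J_linear.
by rewrite -!word2 (spec_circ opsP) !JM !J_in had2 !unit_mul_inj.
Qed.

(* The cup-one/d formula says exactly that the coproduct is multiplicative. *)
Let red_mul a b : red (mu a b) = had (red a) (red b).
Proof.
rewrite {1}/red -(spec11 opsP) d_cup1.
rewrite [in RHS]/red (linear_mapB (had_l _)) !(linear_mapB (had_r _)).
rewrite [had (prim a) (J _)](hadamardC unit_mulC unit_mul_linear).
rewrite -/had had_prim !had_J_prim // had_J //.
rewrite (linear_mapB J_linear) !(linear_mapD J_linear) !(linear_mapN J_linear).
rewrite !JM !J_in !opprD !opprK !addrA.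
by rewrite [LHS](ACl (1*2*3*5*4*6))%AC.
Qed.

(** Bilinear expansion: [e * e] is the identity for [had] in degree two, so [red_mul] is the only
    case with content. *)
Let coprod_mul x y : coprod (unit_mul x y) = had (coprod x) (coprod y).
Proof.
case: x y => [r a] [s b]; rewrite /coprod /=.
have had1 t : grade 2 t -> had (e * e) t = t.
  exact: (hadamard_id2 unit_mulC unit_mul_linear unit_mul1).
rewrite had_l (had_r (e * e)) (had_r (red a)).
rewrite [had (red a) (e * e)](hadamardC unit_mulC unit_mul_linear).
rewrite -/had !had1 //; last exact: in2_grade.
rewrite !(linear_mapD red_linear) !(linear_mapZ red_linear) red_mul.
by rewrite [r *: (_ + red b)]scalerDr scalerA !addrA.
Qed.

(** [cl] and [cr] are [Delta (x) 1] and [1 (x) Delta] on degree two; 0 is a default value on words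
    of any other length. *)
Let cl : U -> U := tm_lift (fun w => if w is [:: x; y] then coprod x * tm_in U y else 0).
Let cr : U -> U := tm_lift (fun w => if w is [:: x; y] then tm_in U x * coprod y else 0).

Let clM : multilinear
  (fun w : seq N => if w is [:: x; y] then coprod x * tm_in U y else 0).
Proof.
apply: (@multilinear2 R N U (fun x y => coprod x * tm_in U y)) => b c x y.
  by rewrite coprod_linear mulrPl.
by rewrite linearP mulrPr.
Qed.

Let crM : multilinear
  (fun w : seq N => if w is [:: x; y] then tm_in U x * coprod y else 0).
Proof.
apply: (@multilinear2 R N U (fun x y => tm_in U x * coprod y)) => b c x y.
  by rewrite linearP mulrPl.
by rewrite coprod_linear mulrPr.
Qed.

Let cl_linear : linear cl. Proof. exact: tm_lift_linear. Qed.
Let cr_linear : linear cr. Proof. exact: tm_lift_linear. Qed.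
Let cl2 x y : cl (tm_in U x * tm_in U y) = coprod x * tm_in U y.
Proof. by rewrite word2 /cl lift_word. Qed.
Let cr2 x y : cr (tm_in U x * tm_in U y) = tm_in U x * coprod y.
Proof. by rewrite word2 /cr lift_word. Qed.

Let cl_had s t : grade 2 s -> grade 2 t -> cl (had s t) = had (cl s) (cl t).
Proof.
move=> hs ht; move: s hs; apply: grade_eq => [c x y|c x y|[|x [|y []]] // _].
- by rewrite had_l cl_linear.
- by rewrite cl_linear had_l.
move: t ht; apply: grade_eq => [c u v|c u v|[|x' [|y' []]] // _].
- by rewrite had_r cl_linear.
- by rewrite cl_linear had_r.
rewrite -!word2 had2 !cl2 coprod_mul.
(* The left factor [coprod x] has degree two, so the cut comes after two letters; in [cr_had] it
   comes after one. *)
rewrite [RHS](hadamardM unit_mulC unit_mul_linear (n := 2)) //.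
by rewrite hadamard_tin //; [apply: unit_mulC|apply: unit_mul_linear].
Qed.

Let cr_had s t : grade 2 s -> grade 2 t -> cr (had s t) = had (cr s) (cr t).
Proof.
move=> hs ht; move: s hs; apply: grade_eq => [c x y|c x y|[|x [|y []]] // _].
- by rewrite had_l cr_linear.
- by rewrite cr_linear had_l.
move: t ht; apply: grade_eq => [c u v|c u v|[|x' [|y' []]] // _].
- by rewrite had_r cr_linear.
- by rewrite cr_linear had_r.
rewrite -!word2 had2 !cr2 coprod_mul.
rewrite [RHS](hadamardM unit_mulC unit_mul_linear (n := 1)); try exact: grade_tin.
by rewrite hadamard_tin //; [apply: unit_mulC|apply: unit_mul_linear].
Qed.

(** On [x (x) y] the terms [x (x) 1 (x) y] of the two sides cancel, and the Leibniz sign in degree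
    one turns [- dx (x) y + x (x) dy] into [- d (x (x) y)]. *)
Let coassoc_J t : grade 2 t -> cl (J t) - cr (J t) = e * J t - J t * e - J (d t).
Proof.
move: t; apply: grade_eq => [c x y|c x y|[|x [|y []]] // _].
- by rewrite J_linear cl_linear cr_linear scalerBr opprD addrACA.
- rewrite [d _]linearP J_linear mulrPr mulrPl [J _ in X in _ - X]J_linear.
  by rewrite !opprD !scalerBr !addrA (ACl (1*3*5*2*4*6))%AC.
rewrite -word2 (d_leibniz (i := 1)) ?expr1 ?mulN1r; last exact: grade_tin.
rewrite mulNr (linear_mapB J_linear) !JM !J_in cl2 cr2 /coprod /= !scale0r !add0r.
rewrite /red /prim -!/(inj _) mulrBl mulrBr mulrDl mulrDr !mulrA.
by rewrite !opprD !opprK !addrA (ACl (2*4*3*6*(1*5)))%AC /= subrr addr0.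
Qed.

(** The words made of [a] and two letters [e] cancel, leaving [e * J (d a) - J (d a) * e]. Then
    [coassoc_J] at [d a] enters with a minus sign, because [red] subtracts [d]: it cancels this
    commutator and contributes [J (d (d a))]. *)
Let coassoc a : cl (coprod (0, a)) - cr (coprod (0, a)) = J (d (d (tm_in T a))).
Proof.
have coprod_e : coprod (1, 0) = e * e.
  by rewrite /coprod /= scale1r (linear_map0 red_linear) addr0.
have coprodE : coprod (0, a) = inj a * e + e * inj a - J (d (tm_in T a)).
  by rewrite /coprod /= scale0r add0r.
have -> : cl (coprod (0, a)) =
    coprod (0, a) * e + e * e * inj a - cl (J (d (tm_in T a))).
  by rewrite {1}coprodE (linear_mapB cl_linear) (linear_mapD cl_linear) !cl2 coprod_e.
have -> : cr (coprod (0, a)) =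
    inj a * (e * e) + e * coprod (0, a) - cr (J (d (tm_in T a))).
  by rewrite {1}coprodE (linear_mapB cr_linear) (linear_mapD cr_linear) !cr2 coprod_e.
have := coassoc_J (dgrade a); move/eqP; rewrite subr_eq => /eqP ->.
rewrite coprodE mulrBl mulrBr mulrDl mulrDr !mulrA.
rewrite !opprD !opprK !addrA.
rewrite [LHS](ACl ((1*9)*(2*10)*(3*6)*(4*11)*(5*12)*(8*13)*7))%AC /=.
by rewrite !subrr !addNr !add0r.
Qed.

Lemma square_zero_mul a b :
  d (d (tm_in T a)) = 0 -> d (d (tm_in T b)) = 0 -> d (d (tm_in T (mu a b))) = 0.
Proof.
have d2P c : d (d (tm_in T c)) = 0 <-> cl (coprod (0, c)) = cr (coprod (0, c)).
  have J0 := linear_map0 J_linear.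
  split=> h; first by apply/subr0_eq; rewrite coassoc h.
  by apply: J_inj; rewrite -coassoc h subrr J0.
move=> /d2P ha /d2P hb; apply/d2P; rewrite -unit_mul_inj coprod_mul.
by rewrite cl_had ?cr_had ?ha ?hb.
Qed.

End Coproduct.

Section Unitization.
Variables (R : comNzRingType) (M : lmodType R) (T : tensor_model M).
Variables (mu : M -> M -> M) (ops : cup_one_ops T).
Hypotheses (muC : commutative mu) (muA : associative mu).
Hypothesis opsP : cup_one_spec mu ops.

Lemma tensor_unitized : com_algebra_on (unitized (@grade R M T))
  (unitized_mul ops) (unitized_one T).
Proof.
have l0 := fun t => linear_map0 (spec11_linearl opsP t).
have mulC a b : grade 1 a -> grade 1 b -> cup11 ops a b = cup11 ops b a.
  by move=> /grade1P[x ->] /grade1P[y ->]; rewrite !(spec11 opsP) muC.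
have uC a b : unitized (@grade R M T) a -> unitized (@grade R M T) b ->
    unitized_mul ops a b = unitized_mul ops b a.
  move: a b => [r a] [s b] ha hb; rewrite /unitized_mul /= [r * s]mulrC.
  by rewrite mulC // [r *: b + _]addrC.
have ul (c : R) (a a' b : R^o * T) :
    unitized_mul ops (c *: a + a') b = c *: unitized_mul ops a b + unitized_mul ops a' b.
  move: a a' b => [r a] [r' a'] [s b]; congr (_, _).
    by rewrite -[LHS]/((c * r + r') * s) -[RHS]/(c * (r * s) + r' * s) mulrDl mulrA.
  rewrite -[LHS]/((c * r + r') *: b + s *: (c *: a + a') + cup11 ops (c *: a + a') b).
  rewrite -[RHS]/(c *: (r *: b + s *: a + cup11 ops a b)
    + (r' *: b + s *: a' + cup11 ops a' b)).
  rewrite (spec11_linearl opsP) scalerDl !scalerDr !scalerA [s * c]mulrC !addrA.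
  by rewrite [LHS](ACl (1*3*5*2*4*6))%AC.
have uS : submodule (unitized (@grade R M T)).
  split; first exact: lspan0.
  by move=> c [r a] [s b] ha hb; apply: lspanP.
have uM a b : unitized (@grade R M T) a -> unitized (@grade R M T) b ->
    unitized (@grade R M T) (unitized_mul ops a b).
  move: a b => [r a] [s b] /= ha hb; apply: gradeD; first by apply: gradeD; apply: gradeZ.
  move/grade1P: ha => [x ->]; move/grade1P: hb => [y ->].
  by rewrite (spec11 opsP); apply: grade_tin.
split=> //.
- split=> [//|c a a' b _ _ _|c a b b' ha hb hb']; first exact: ul.
  rewrite uC //; last exact: uS.2.
  by rewrite ul uC // [X in _ + X]uC.
- exact: lspan0.
- move=> [r a] _; rewrite /unitized_mul /= mul1r scale1r scaler0 addr0.
  by rewrite l0 addr0.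
- move=> [r a] [s b] [t c] /grade1P[x /= ->] /grade1P[y /= ->] /grade1P[z /= ->].
  rewrite /unitized_mul /=; congr (_, _); first by rewrite mulrA.
  rewrite !(linear_mapD (spec11_linearl opsP _)) !(linear_mapZ (spec11_linearl opsP _)).
  rewrite !(linear_mapD (spec11_linearr opsP _)) !(linear_mapZ (spec11_linearr opsP _)).
  rewrite !(spec11 opsP) muA !scalerDr !scalerA [t * r]mulrC [t * s]mulrC !addrA.
  by rewrite [LHS](ACl (1*2*4*6*3*5*7))%AC.
Qed.

End Unitization.

(** * From square zero in degree one to a cup-one dga *)

Section SquareZero.
Variables (R : comNzRingType) (M : lmodType R) (T : tensor_model M).
Variable d : {linear T -> T}.
Hypotheses (d_degree : degree_one (@grade R M T) d)
  (d_leibniz : graded_leibniz (@grade R M T) d).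

Lemma leibniz_d1 : d 1 = 0.
Proof.
have h1 : grade 0 (1 : T) by rewrite -word_nil; apply: (grade_word T [::]).
have := d_leibniz 1 h1; rewrite expr0 !mulr1 mul1r => h.
by apply: (addrI (d 1)); rewrite addr0.
Qed.

Lemma square_zero_gen :
  (forall a, d (d (tm_in T a)) = 0) -> forall u, d (d u) = 0.
Proof.
move=> d2; apply: (@tensor_eq _ _ _ _ (fun u => d (d u)) (fun=> 0)) => [c x y|c x y|w].
- by rewrite !linearP.
- by rewrite scaler0 addr0.
elim: w => [|a w IH]; first by rewrite word_nil leibniz_d1 raddf0.
have da := d_degree (grade_tin T a).
rewrite word_cons (d_leibniz _ (grade_tin T a)) expr1 mulN1r mulNr raddfB /=.
(* As [d a] has degree two, [d (d a * w)] yields [+ d a * d w]; [d (a * d w)] yields the same term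
   and is subtracted, so the mixed terms cancel. *)
rewrite (d_leibniz _ da) (d_leibniz _ (grade_tin T a)) d2 IH.
by rewrite sqrrN expr1n expr1 mul1r mul0r add0r mulr0 addr0 subrr.
Qed.

Lemma tensor_cup_one_dga (mu : M -> M -> M) (ops : cup_one_ops T) :
  commutative mu -> associative mu -> (forall a, linear (mu a)) ->
  cup_one_spec mu ops ->
  (forall a b, cup1_d_formula d ops (tm_in T a) (tm_in T b)) ->
  (forall u, d (d u) = 0) -> cup_one_dga (@grade R M T) d ops.
Proof.
move=> muC muA mu_r opsP d_cup1 d2.
have cupG a b : grade 1 a -> grade 1 b -> grade 1 (cup11 ops a b).
  by move=> /grade1P[x ->] /grade1P[y ->]; rewrite (spec11 opsP); apply: grade_tin.
have circG s t : grade 2 s -> grade 2 t -> grade 2 (circ ops s t).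
  move=> hs ht; move: s hs; apply: grade_ind => [|c u v hu hv|[|x [|y []]] // _].
  + rewrite (linear_map0 (spec_circ_linearl opsP t)); exact: lspan0.
  + by rewrite (spec_circ_linearl opsP); apply: lspanP.
  move: t ht; apply: grade_ind => [|c u v hu hv|[|x' [|y' []]] // _].
  + rewrite (linear_map0 (spec_circ_linearr opsP _)); exact: lspan0.
  + by rewrite (spec_circ_linearr opsP); apply: lspanP.
  by rewrite -!word2 (spec_circ opsP) word2; apply: (grade_word T [:: _; _]).
split.
- split; [exact: tensor_graded|exact: linearP|exact: d_degree|exact: d2|exact: d_leibniz].
- split; [exact: cupG|move=> c a a' b _ _ _|move=> c a b b' _ _ _].
    exact: (spec11_linearl opsP).
  exact: (spec11_linearr opsP).
- split; [|move=> c a a' b _ _ _|move=> c a b b' _ _ _].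
  + move=> s b /tensor_D2 hs /grade1P[z ->]; move: s hs.
    apply: grade_ind => [|c u v hu hv|[|x [|y []]] // _].
    * rewrite (linear_map0 (spec21_linearl opsP _)); exact: lspan0.
    * by rewrite (spec21_linearl opsP); apply: lspanP.
    rewrite -word2 (spec21 opsP) !word2.
    by apply: gradeD; apply: (grade_word T [:: _; _]).
  + exact: (spec21_linearl opsP).
  + exact: (spec21_linearr opsP).
- split; [|move=> c a a' b _ _ _|move=> c a b b' _ _ _].
  + by move=> s t /tensor_D2 hs /tensor_D2 ht; apply/tensor_D2/circG.
  + exact: (spec_circ_linearl opsP).
  + exact: (spec_circ_linearr opsP).
- exact: (tensor_unitized muC muA opsP).
- move=> _ _ _ /grade1P[a ->] /grade1P[b ->] /grade1P[c ->].
  by rewrite (spec21 opsP) !(spec11 opsP) addrC.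
- move=> _ _ _ _ /grade1P[a ->] /grade1P[b ->] /grade1P[a' ->] /grade1P[b' ->].
  by rewrite (spec_circ opsP) !(spec11 opsP).
(* Elements of degree zero are scalars, hence central and killed by [d]: both sides are 0. *)
- move=> a _ _ /grade0P[c ->]; rewrite linearZ_LR leibniz_d1 scaler0.
  by rewrite (linear_map0 (spec11_linearr opsP a)) -scalerAl -scalerAr mulr1 mul1r subrr.
- by move=> _ _ /grade1P[a ->] /grade1P[b ->] _ _; apply: d_cup1.
Qed.

End SquareZero.

(** * Newton basis of integer-valued polynomials *)

Section NewtonBasis.
Variable X : choiceType.
Local Notation polyQ := {malg rat[{cmonom X}]}.

Definition newton (k : {cmonom X}) : polyQ := \prod_(x <- finsupp k) pzeta (k x) x.

Lemma pzeta0 (x : X) : pzeta 0 x = 1.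
Proof. by rewrite /pzeta big_ord0 fact0 invr1 scale1r. Qed.

(** A rearrangement of [(x - n) binom(x, n) = (n + 1) binom(x, n + 1)]. *)
Lemma pzetaS n (x : X) :
  pvar x * pzeta n x = n.+1%:R *: pzeta n.+1 x + n%:R *: pzeta n x.
Proof.
rewrite /pzeta big_ord_recr /= factS natrM invfM.
set P := \prod_(i < n) _; set u : rat := n`!%:R^-1.
have -> : n.+1%:R *: ((n.+1%:R^-1 * u) *: (P * (pvar x - n%:R))) =
    u *: (P * (pvar x - n%:R)) :> polyQ.
  by rewrite scalerA mulrA mulfV ?mul1r // pnatr_eq0.
have -> : n%:R *: (u *: P) = u *: (P * n%:R) :> polyQ.
  by rewrite scalerA mulrC -scalerA scaler_nat mulr_natr.
by rewrite -scalerDr -mulrDr subrK -scalerAr mulrC.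
Qed.

Lemma newtonEw (k : {cmonom X}) (E : {fset X}) : (finsupp k `<=` E)%fset ->
  newton k = \prod_(x <- E) pzeta (k x) x.
Proof.
move=> le; rewrite [LHS](big_fset_incl _ le) => //= x _.
by rewrite memNfinsupp => /eqP ->; rewrite pzeta0.
Qed.

Lemma newton1 : newton 1%M = 1.
Proof. by rewrite /newton mdom1 big_seq_fset0. Qed.

Let split_prod (A : comNzRingType) (F : nat -> X -> A) (E : {fset X}) x (j k : X -> nat) :
  x \in E -> (forall y, y != x -> j y = k y) ->
  \prod_(y <- E) F (j y) y = F (j x) x * \prod_(y <- (E `\ x)%fset) F (k y) y.
Proof.
move=> xE jk; rewrite (big_fsetD1 x xE); congr (_ * _).
by apply: eq_big_seq => y; rewrite in_fsetD1 => /andP[/jk -> _].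
Qed.

Let lin2_mul (A : comAlgType rat) (a b : rat) (v z z' P : A) :
  v * z = a *: z' + b *: z -> v * (z * P) = a *: (z' * P) + b *: (z * P).
Proof. by move=> h; rewrite mulrA h mulrDl -!scalerAl. Qed.

Lemma newtonX x (k : {cmonom X}) : pvar x * newton k =
  (k x).+1%:R *: newton (k * ucm x)%M + (k x)%:R *: newton k.
Proof.
pose E := (x |` finsupp k)%fset.
have xE : x \in E by rewrite /E in_fset1U eqxx.
pose P := \prod_(y <- (E `\ x)%fset) pzeta (k y) y.
have EX (j : {cmonom X}) : (finsupp j `<=` E)%fset ->
    (forall y, y != x -> j y = k y) -> newton j = pzeta (j x) x * P.
  by move=> le jk; rewrite (newtonEw le); apply: split_prod.
have -> : newton k = pzeta (k x) x * P by apply: EX; rewrite ?fsubsetUr.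
have -> : newton (k * ucm x)%M = pzeta (k x).+1 x * P.
  rewrite EX; first by rewrite cmM cmUU addn1.
    by rewrite mdomD mdomU fsetUC.
  by move=> y yx; rewrite cmM cmU eq_sym (negPf yx) addn0.
exact/lin2_mul/pzetaS.
Qed.

Definition newton_sum (g : {malg rat[{cmonom X}]}) : polyQ :=
  \sum_(k <- msupp g) g@_k *: newton k.

Lemma newton_sumEw (E : {fset {cmonom X}}) g : (msupp g `<=` E)%fset ->
  newton_sum g = \sum_(k <- E) g@_k *: newton k.
Proof.
move=> le; rewrite [LHS](big_fset_incl _ le) => //= k _ /mcoeff_outdom ->.
by rewrite scale0r.
Qed.

Lemma newton_sum_linear : linear newton_sum.
Proof.
move=> c x y; pose E := (msupp x `|` msupp y `|` msupp (c *: x + y))%fset.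
rewrite (@newton_sumEw E) ?fsubsetUr // (@newton_sumEw E x); last first.
  by rewrite /E -fsetUA fsubsetUl.
rewrite (@newton_sumEw E y); last first.
  by rewrite /E [(msupp x `|` _)%fset]fsetUC -fsetUA fsubsetUl.
rewrite scaler_sumr -big_split /=; apply: eq_bigr => k _.
by rewrite mcoeffD mcoeffZ scalerDl scalerA.
Qed.

Lemma newton_sumU k : newton_sum << k >> = newton k.
Proof. by rewrite (newton_sumEw msuppU_le) big_seq_fset1 mcoeffUU scale1r. Qed.

Let span_mul (A : comAlgType rat) (S : A -> Prop) (K : Type) (b : K -> A) (v : A) :
  S 0 -> (forall c p r, S p -> S r -> S (c *: p + r)) -> (forall k, S (v * b k)) ->
  forall (s : seq K) c, S (v * \sum_(k <- s) c k *: b k).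
Proof.
move=> S0 SL Sb s c; rewrite mulr_sumr; elim: s => [|k s IH]; first by rewrite big_nil.
by rewrite big_cons -scalerAr; apply: SL.
Qed.

(** By [newtonX] the span of the [newton k] is stable under multiplication by variables, and it
    contains [newton 1 = 1]; monomials follow by induction on the degree. The boolean [==] is what
    [xchoose] requires in [zcoord]. *)
Lemma newton_spanned (q : polyQ) : exists g, newton_sum g == q.
Proof.
pose S q := exists g, newton_sum g = q.
suff [g <-] : S q by exists g.
have SL c p r : S p -> S r -> S (c *: p + r).
  by move=> [g <-] [h <-]; exists (c *: g + h); rewrite newton_sum_linear.
have S0 : S 0 by exists 0; rewrite (linear_map0 newton_sum_linear).
have SX x p : S p -> S (pvar x * p).
  move=> [g <-]; apply: span_mul => // k; rewrite newtonX; apply: (SL).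
    by exists << (k * ucm x)%M >>; rewrite newton_sumU.
  by rewrite -[_ *: _]addr0; apply: SL => //; exists << k >>; rewrite newton_sumU.
have Sm n : forall k : {cmonom X}, mdeg k = n -> S << k >>.
  elim: n => [|n IH] k kn.
    move/eqP: kn; rewrite mdeg_eq0 => /eqP ->.
    by exists << 1%M >>; rewrite newton_sumU newton1.
  have /fset0Pn[x xk] : finsupp k != fset0.
    by apply: contra_eqN kn => /eqP h; rewrite mdegE h big_seq_fset0.
  have kE : k = (ucm x * divcm k (ucm x))%M.
    apply/eqP/cmP => y; rewrite cmM divcmE ucmE; have [<-|_] := eqVneq x y.
      by rewrite subnKC // lt0n cmE_neq0.
    by rewrite add0n subn0.
  have -> : << k >> = pvar x * << divcm k (ucm x) >> :> polyQ.
    by rewrite {1}kE /pvar malgM_def fgmulUU mulr1.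
  by apply/SX/IH; move: kn; rewrite {1}kE mdegM mdegU => [] [].
have := malg_linear_sum (idfun : {linear polyQ -> polyQ}) q.
rewrite /= => ->; elim: (enum_fset _) => [|k s IH]; first by rewrite big_nil.
by rewrite big_cons; apply: SL => //; apply: Sm.
Qed.

Lemma peval_newton (l k : {cmonom X}) :
  peval (fun x => (l x)%:Z) (newton k) = \prod_(x <- finsupp k) 'C(l x, k x)%:R.
Proof.
rewrite rmorph_prod; apply: eq_bigr => x _ /=; move: (k x) => n.
rewrite /pzeta /peval mmapZ -/(peval _ _) rmorph_prod /=.
apply: (canLR (mulKf _)); first by rewrite pnatr_eq0 -lt0n fact_gt0.
rewrite mulrC -natrM bin_ffact ffact_prod natr_prod.
have E i : peval (fun x => (l x)%:Z) (pvar x - i%:R) = (l x)%:R - i%:R.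
  by rewrite rmorphB rmorph_nat /= peval_var.
have [le_nk|lt_kn] := leqP n (l x).
  by apply: eq_bigr => i _; rewrite E natrB // ltnW // (leq_trans _ le_nk).
(* When [l x < n], both products contain the factor of index [l x], which is 0. *)
rewrite (bigD1 (Ordinal lt_kn)) //= E subrr mul0r.
by rewrite (bigD1 (Ordinal lt_kn)) //= subnn mul0r.
Qed.

(* Evaluation at the nonnegative points is unitriangular in the Newton basis. *)
Lemma newton_sum_int g :
  newton_sum g \in @int_valued X -> forall k, g@_k \is a Num.int.
Proof.
move=> /asboolP gint k; have [n] := ubnP (mdeg k).
elim: n k => // n IH l; rewrite ltnS => ln.
have [|/mcoeff_outdom -> //] := boolP (l \in msupp g) => lg.
have := gint (fun x => (l x)%:Z); rewrite /newton_sum raddf_sum (big_fsetD1 l lg) /=.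
rewrite rpredDr.
  rewrite /peval mmapZ -/(peval _ _) peval_newton big1 ?mulr1 // => x _.
  by rewrite binn.
(* A term [k] other than [l] vanishes at the point [l] if [k] exceeds [l] at some variable;
   otherwise [k] has smaller degree and [IH] applies. *)
rewrite big_seq rpred_sum // => k; rewrite in_fsetD1 => /andP[kl _].
rewrite /peval mmapZ -/(peval _ _) peval_newton.
have [/allP kle|/allPn[x xk]] :=
    boolP (all (fun x => k x <= l x)%N (finsupp k)); last first.
  rewrite -ltnNge => lt; rewrite (big_fsetD1 x xk) /= bin_small // mul0r mulr0.
  exact: rpred0.
apply: rpredM; last by apply: rpred_prod => x _; apply: rpred_nat.
apply: IH; apply: leq_trans ln.
have {}kle x : (k x <= l x)%N.
  have [/kle //|] := boolP (x \in finsupp k).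
  by rewrite memNfinsupp => /eqP ->.
have lE : l = (k * divcm l k)%M by apply/eqP/cmP => x; rewrite cmM divcmE subnKC.
rewrite {1}lE mdegM -{1}[mdeg k]addn0 ltn_add2l lt0n mdeg_eq0.
by apply: contra_neqN kl => /eqP h; rewrite lE h mulm1.
Qed.

Lemma newton_sum_inj : injective newton_sum.
Proof.
move=> g h gh; apply/malgP => k; apply/eqP; rewrite -subr_eq0 -mcoeffB.
set c := _@_k; apply/negP => /negP c0.
(* Integrality gives injectivity: after scaling by [(2 c)^-1] the Newton sum is still 0, hence
   integer-valued, but the coefficient at [k] is one half, against [newton_sum_int]. *)
have : newton_sum ((2%:R * c)^-1 *: (g - h)) \in @int_valued X.
  rewrite (linear_mapZ newton_sum_linear) (linear_mapB newton_sum_linear) gh subrr.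
  by rewrite scaler0; apply: rpred0.
by move/newton_sum_int/(_ k); rewrite mcoeffZ -/c invfM mulfVK.
Qed.

Definition zcoord (q : polyQ) := xchoose (newton_spanned q).

Lemma zcoordK q : newton_sum (zcoord q) = q.
Proof. exact/eqP/(xchooseP (newton_spanned q)). Qed.

(** Coordinates obtained by choice are linear because they are unique. *)
Lemma zcoord_linear : linear zcoord.
Proof. by move=> c p q; apply: newton_sum_inj; rewrite newton_sum_linear !zcoordK. Qed.

(** The coordinate is already integral ([zcoefE]); [Num.floor] only returns it as an [int]. *)
Definition zcoef (k : {cmonom X}) (q : IntZ X) : int := Num.floor (zcoord q)@_k.

Lemma zcoefE k (q : IntZ X) : (zcoef k q)%:~R = (zcoord q)@_k.
Proof. by apply: floorK; apply: newton_sum_int; rewrite zcoordK; apply: valP. Qed.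

Lemma intz_val_scale (c : int) (q : IntZ X) : intz_val (c *: q) = c%:~R *: intz_val q.
Proof.
apply: etrans (raddfMz (\val : IntZ X -> polyQ) c q) _.
exact/esym/scaler_int.
Qed.

Lemma zcoef_linear k : linear (zcoef k : IntZ X -> int^o).
Proof.
move=> c p q; apply: (@intr_inj rat); rewrite zcoefE.
rewrite -[intz_val _]/(intz_val (c *: p) + intz_val q) intz_val_scale zcoord_linear.
by rewrite mcoeffD mcoeffZ -!zcoefE rmorphD /= -[c *: _]/(c * _) rmorphM.
Qed.

Definition zbasis (k : {cmonom X}) : IntZ X := \prod_(x <- finsupp k) zeta (k x) x.

Lemma zcoefK (q : IntZ X) : q = \sum_(k <- msupp (zcoord q)) zcoef k q *: zbasis k.
Proof.
apply: val_inj; rewrite raddf_sum -[LHS]zcoordK; apply: eq_bigr => k _ /=.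
rewrite [RHS]intz_val_scale zcoefE; congr (_ *: _).
exact/esym/(rmorph_prod (\val : IntZ X -> polyQ)).
Qed.

(** The Newton coefficients of [q] are integers, so [q] lies in the subring generated by the
    [zeta n x]. *)
Lemma IntZ_ind (B : IntZ X -> Prop) : B 1 ->
  (forall p q, B p -> B q -> B (p - q)) -> (forall p q, B p -> B q -> B (p * q)) ->
  (forall n x, B (zeta n x)) -> forall q, B q.
Proof.
move=> B1 BB BM Bz q.
have B0 : B 0 by rewrite -(subrr 1); apply: BB.
have BN p : B p -> B (- p) by move=> Bp; rewrite -sub0r; apply: BB.
have BD p r : B p -> B r -> B (p + r).
  by move=> Bp Br; rewrite -[r]opprK; apply/BB/BN.
have BMn p n : B p -> B (p *+ n).
  by move=> Bp; elim: n => [|n IH]; rewrite ?mulr0n // mulrS; apply: BD.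
have BZ (c : int) p : B p -> B (c *: p).
  move=> Bp; rewrite -[c *: p]/(p *~ c); case: c => n; first exact: BMn.
  exact/(BN (p *+ n.+1))/BMn.
have Bb k : B (zbasis k).
  rewrite /zbasis; elim: (enum_fset _) => [|x s IH]; first by rewrite big_nil.
  by rewrite big_cons; apply: BM.
rewrite (zcoefK q); elim: (enum_fset _) => [|k s IH]; first by rewrite big_nil.
by rewrite big_cons; apply: BD => //; apply: BZ.
Qed.

End NewtonBasis.

(** * Constant terms, torsion and binomials of integer-valued polynomials *)

Section ConstantTerm.
Variable X : choiceType.

Definition const_term (q : IntZ X) : int := Num.floor (intz_val q)@_1%M.

Lemma const_termE q : (const_term q)%:~R = (intz_val q)@_1%M.
Proof. by apply/floorK/const_int. Qed.

Lemma const_termB p q : const_term (p - q) = const_term p - const_term q.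
Proof.
by apply: (@intr_inj rat); rewrite rmorphB /= !const_termE /= mcoeffB.
Qed.

Lemma const_term1 : const_term 1 = 1.
Proof. by apply: (@intr_inj rat); rewrite const_termE /= rmorph1. Qed.

Lemma const_termM p q : const_term (p * q) = const_term p * const_term q.
Proof.
by apply: (@intr_inj rat); rewrite rmorphM /= !const_termE /= rmorphM.
Qed.

HB.instance Definition _ :=
  GRing.isZmodMorphism.Build (IntZ X) int const_term const_termB.
HB.instance Definition _ := GRing.isMonoidMorphism.Build (IntZ X) int const_term
  (conj const_term1 const_termM).

Lemma const_term_var x : const_term (varZ x) = 0.
Proof.
by apply: (@intr_inj rat); rewrite const_termE mcoeffU1 cm1_eq1.
Qed.

Lemma fact_zeta n (x : X) : zeta n x *+ n`! = \prod_(i < n) (varZ x - i%:R).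
Proof.
apply: val_inj; apply: etrans (raddfMn (\val : IntZ X -> _) _ _) _.
apply: etrans _ (esym (rmorph_prod (\val : IntZ X -> {malg rat[{cmonom X}]}) _ _ _)).
rewrite /= /pzeta -scaler_nat scalerA mulfV ?scale1r; last first.
  by rewrite pnatr_eq0 -lt0n fact_gt0.
apply: eq_bigr => i _; rewrite -[RHS]/(pvar x - intz_val i%:R); congr (_ - _).
exact/esym/(rmorph_nat (\val : IntZ X -> {malg rat[{cmonom X}]})).
Qed.

(** The factor of index 0 in [fact_zeta] is [x] itself, and [n!] cancels in [int]. *)
Lemma const_term_zeta n x : (0 < n)%N -> const_term (zeta n x) = 0.
Proof.
move=> n0; have : const_term (zeta n x *+ n`!) = 0.
  rewrite fact_zeta rmorph_prod (bigD1 (Ordinal n0)) //= subr0 const_term_var.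
  exact: mul0r.
by rewrite raddfMn /= => /eqP; rewrite mulrn_eq0 eqn0Ngt fact_gt0 => /eqP.
Qed.

Lemma intz_torsion_free (q : IntZ X) n : (0 < n)%N -> q *+ n = 0 -> q = 0.
Proof.
move=> n0 qn; apply: val_inj; rewrite /=.
have := congr1 (\val : IntZ X -> {malg rat[{cmonom X}]}) qn.
rewrite (raddfMn (\val : IntZ X -> {malg rat[{cmonom X}]})) /= => h.
apply/malgP => k; rewrite mcoeff0; apply/eqP.
have := congr1 (fun g : {malg rat[{cmonom X}]} => g@_k) h; rewrite mcoeffMn mcoeff0.
by move/eqP; rewrite mulrn_eq0 eqn0Ngt n0.
Qed.

Lemma intz_binomial (q : IntZ X) n :
  exists b : IntZ X, b *+ n`! = \prod_(i < n) (q - i%:R).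
Proof.
have valM := rmorph_prod (\val : IntZ X -> {malg rat[{cmonom X}]}).
have n0 : n`!%:R != 0 :> rat by rewrite pnatr_eq0 -lt0n fact_gt0.
pose P := intz_val (\prod_(i < n) (q - i%:R)).
have bP : n`!%:R^-1 *: P \in @int_valued X.
  apply/asboolP => f; rewrite /peval mmapZ -/(peval f _) /P.
  have /asboolP/(_ f)/intrP[z qz] := valP q.
  have -> : peval f (intz_val (\prod_(i < n) (q - i%:R))) =
      (\prod_(i < n) (z - i%:R))%:~R.
    rewrite [intz_val _]valM !rmorph_prod /=; apply: eq_bigr => i _.
    have vE : intz_val (q - i%:R) = intz_val q - i%:R.
      by rewrite -(rmorph_nat (\val : IntZ X -> {malg rat[{cmonom X}]})).
    rewrite -[X in peval f X]/(intz_val (q - i%:R)) vE.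
    by rewrite rmorphB rmorph_nat /= [peval f _]qz rmorphB /= rmorph_nat.
  have [k ->] := int_ffact_dvd z n.
  by rewrite rmorphM /= rmorph_nat mulrCA mulVf ?mulr1 ?intr_int.
exists (MkIntZ bP); apply: val_inj.
apply: etrans (raddfMn (\val : IntZ X -> _) _ _) _.
by rewrite /= -scaler_nat scalerA mulfV ?scale1r.
Qed.

End ConstantTerm.

(** * Frobenius and falling factorials in characteristic p *)

Section Fermat.
Variables (p : nat) (p_pr : prime p).

Lemma Fp_prod_reindex (A : comNzRingType) (G : 'F_p -> A) :
  \prod_(x : 'F_p) G x = \prod_(i < p) G i%:R.
Proof.
have e := Fp_cast p_pr.
rewrite (reindex (fun i : 'I_p => i%:R : 'F_p)) //.
exists (cast_ord e) => [i _|x _]; last by rewrite natr_Zp.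
by apply: val_inj; rewrite /= val_Fp_nat // modn_small.
Qed.

Lemma Fp_fact_neq0 n : (n < p)%N -> n`!%:R != 0 :> 'F_p.
Proof.
elim: n => [_|n IH lt_np]; first exact: oner_neq0.
rewrite factS natrM mulf_neq0 ?IH 1?ltnW //.
by apply/eqP => /(congr1 val) /=; rewrite val_Fp_nat // modn_small.
Qed.

Variable A : comAlgType 'F_p.

Lemma Fp_alg_pchar : p \in [pchar A].
Proof.
rewrite inE p_pr -(scaler_nat p (1 : A)) (_ : p%:R = 0 :> 'F_p) ?scale0r ?eqxx //.
exact: (pcharf0 (pchar_Fp p_pr)).
Qed.

(** The factorization of [X^p - X] over ['F_p], evaluated at [a]. *)
Lemma falling_Frobenius (a : A) : \prod_(i < p) (a - i%:R) = a ^+ p - a.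
Proof.
have h := finField_genPoly 'F_p.
have := congr1 (horner_alg a) h; rewrite card_Fp // rmorphB rmorphXn /= rmorph_prod.
rewrite horner_algX => ->; rewrite Fp_prod_reindex; apply: eq_bigr => i _.
by rewrite rmorphB /= horner_algX horner_algC scaler_nat.
Qed.

(** Fixed points of Frobenius form a subring, so [IntZ_ind] leaves the [zeta n x]. For [n < p],
    [n! zeta n x] is a polynomial in [x], and [r x] is fixed since [x^p - x] maps to the same
    element as [p! zeta p x], that is to 0. Finally [n!] is invertible in ['F_p]. *)
Lemma Frobenius_fixed_IntZ (X : choiceType) (r : {rmorphism IntZ X -> A}) :
  (forall n x, (p <= n)%N -> r (zeta n x) = 0) -> forall q, r q ^+ p = r q.
Proof.
move=> r0; have frob := pFrobenius_autE Fp_alg_pchar.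
apply: IntZ_ind => [|q s|q s|n x].
- by rewrite rmorph1 expr1n.
- by move=> hq hs; rewrite rmorphB -frob rmorphB /= !frob hq hs.
- by move=> hq hs; rewrite rmorphM -frob rmorphM /= !frob hq hs.
have [/r0 ->|lt_np] := leqP p n; first by rewrite expr0n eqn0Ngt prime_gt0.
have w_fix : r (zeta n x *+ n`!) ^+ p = r (zeta n x *+ n`!).
  rewrite fact_zeta rmorph_prod -frob rmorph_prod; apply: eq_bigr => i _.
  rewrite rmorphB rmorphB rmorph_nat /= pFrobenius_aut_nat frob; congr (_ - _).
  have /eqP := falling_Frobenius (r (varZ x)); rewrite eq_sym.
  have -> : \prod_(i < p) (r (varZ x) - i%:R) = 0; last by rewrite subr_eq0 => /eqP.
  transitivity (r (\prod_(i < p) (varZ x - i%:R))); last first.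
    by rewrite -fact_zeta raddfMn /= r0 // mul0rn.
  by rewrite rmorph_prod; apply: eq_bigr => j _; rewrite rmorphB rmorph_nat.
move: w_fix; rewrite raddfMn /= -mulr_natl exprMn -[n`!%:R ^+ p]frob.
rewrite pFrobenius_aut_nat !mulr_natl -!scaler_nat => /(congr1 ( *:%R n`!%:R^-1)).
by rewrite !scalerA mulVf ?scale1r // Fp_fact_neq0.
Qed.

End Fermat.

(** * Reduction to the coefficient ring *)

Section ProjFp.
Variables (p : nat) (p_pr : prime p) (X : choiceType).

Lemma projFp_zmod_morphism : zmod_morphism (@projFp p p_pr X).
Proof. exact: (rprojB (zeta_rel_proper p_pr (X := X))). Qed.

HB.instance Definition _ := GRing.isZmodMorphism.Build (IntZ X) (IntFp p_pr X)
  (@projFp p p_pr X) projFp_zmod_morphism.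

Lemma projFp_monoid_morphism : monoid_morphism (@projFp p p_pr X).
Proof. exact: (rproj_monoid_morphism (zeta_rel_proper p_pr (X := X))). Qed.

HB.instance Definition _ := GRing.isMonoidMorphism.Build (IntZ X) (IntFp p_pr X)
  (@projFp p p_pr X) projFp_monoid_morphism.

Lemma projFp_zeta n x : (p <= n)%N -> projFp p_pr (zeta n x) = 0 :> IntFp p_pr X.
Proof.
move=> pn; apply: etrans (raddf0 (rproj (zeta_rel_proper p_pr (X := X)))).
by apply/rproj_eq; rewrite subr0; apply: gen_ideal_gen; right; exists x, n.
Qed.

End ProjFp.

Section Reduction.
Variables (k : coef) (X : choiceType).

Definition redR : {rmorphism IntZ X -> IntR k X} :=
  match k return {rmorphism IntZ X -> IntR k X} with
  | CoefZ => idfun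
  | CoefFp p p_pr => @projFp p p_pr X
  end.

Lemma redR_zero_const q : const_term q = 0 -> redR q \in @zero_constb k X.
Proof.
move=> q0; apply/asboolP; have := const_termE q; rewrite q0 /redR.
by case: k => [|p p_pr] /= /esym h //; exists q.
Qed.

Lemma zero_const_redR a : a \in @zero_constb k X ->
  exists2 q, const_term q = 0 & a = redR q.
Proof.
have c0 (q : IntZ X) : (intz_val q)@_(@mone _) = 0 -> const_term q = 0.
  by move=> h; apply: (@intr_inj rat); rewrite const_termE.
move/asboolP; rewrite /redR; case: k a => [|p p_pr] a /=.
  by move/c0; exists a.
by case=> q /c0 q0 ->; exists q.
Qed.

Lemma redR_var x : redR (varZ x) = varR k x.
Proof. by rewrite /redR; case: k. Qed.

Lemma const_term_aug (q : IntZ X) : const_term (q - (const_term q)%:~R) = 0.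
Proof. by rewrite rmorphB rmorph_int /= intz subrr. Qed.

(** Reduction after removal of the constant term. As 1 has no place in [mIntR], ring-theoretic
    induction takes place on [IntZ X] and is transported along this surjection. *)
Definition aug (q : IntZ X) : mIntR k X := MkMIntR (redR_zero_const (const_term_aug q)).

Lemma augE q : m_val (aug q) = redR q - (const_term q)%:~R.
Proof. by rewrite /= rmorphB rmorph_int. Qed.

Lemma augB q r : aug (q - r) = aug q - aug r.
Proof.
apply: val_inj; rewrite -[RHS]/(m_val (aug q) - m_val (aug r)) [LHS]augE !augE.
by rewrite rmorphB const_termB rmorphB /= !opprD !opprK addrACA.
Qed.

HB.instance Definition _ :=
  GRing.isZmodMorphism.Build (IntZ X) (mIntR k X) aug augB.

Lemma aug1 : aug 1 = 0.
Proof. by apply: val_inj; rewrite [LHS]augE !rmorph1 subrr. Qed.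

(** Removing constant terms costs multiplicativity two corrections, both scalar multiples of [aug q]
    or [aug r]; a submodule closed under [m_mul] absorbs them. *)
Lemma augM q r : aug (q * r) =
  m_mul (aug q) (aug r) + (const_term q)%:~R *: aug r + (const_term r)%:~R *: aug q.
Proof.
have algE (A : comNzRingType) (a b x y : A) :
    a * b - x * y = (a - x) * (b - y) + x * (b - y) + y * (a - x).
  by rewrite -mulrDl subrK mulrBr mulrBr [y * a]mulrC [y * x]mulrC addrA subrK.
apply: val_inj; rewrite -[RHS]/(m_val (aug q) * m_val (aug r)
  + (const_term q)%:~R *: m_val (aug r) + (const_term r)%:~R *: m_val (aug q)).
by rewrite [LHS]augE !augE !rmorphM algE !scaler_int !mulrzl.
Qed.

Lemma aug_surj a : exists2 q, const_term q = 0 & a = aug q.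
Proof.
have [q q0 aq] := zero_const_redR (valP a); exists q => //.
by apply: val_inj; rewrite [RHS]augE q0 subr0.
Qed.

Lemma aug_var x : aug (varZ x) = m_var k x.
Proof.
by apply: val_inj; rewrite [LHS]augE const_term_var subr0 redR_var.
Qed.

Lemma m_mulC : commutative (@m_mul k X).
Proof. by move=> a b; apply: val_inj; rewrite /= mulrC. Qed.

Lemma m_mulA : associative (@m_mul k X).
Proof. by move=> a b c; apply: val_inj; rewrite /= mulrA. Qed.

Section Induction.
Variable P : mIntR k X -> Prop.
Hypotheses (P0 : P 0) (PL : forall c a b, P a -> P b -> P (c *: a + b))
  (PM : forall a b, P a -> P b -> P (m_mul a b)) (Pvar : forall x, P (m_var k x)).

Let augP_B q r : P (aug q) -> P (aug r) -> P (aug (q - r)).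
Proof. by move=> hq hr; rewrite augB addrC -scaleN1r; apply: PL. Qed.

Let augP_M q r : P (aug q) -> P (aug r) -> P (aug (q * r)).
Proof.
move=> hq hr; rewrite augM -addrA addrC -addrA; apply: PL => //.
by apply: PL => //; apply: PM.
Qed.

Let augP_1 : P (aug 1). Proof. by rewrite aug1. Qed.

(** Each factor [x - i] has its [aug] in [P], since [aug] kills the constant. Cancelling [n!]
    depends on the coefficients and is left to [square_zero_ind]. *)
Lemma mIntR_fact_zeta n x : P (aug (zeta n x) *+ n`!).
Proof.
rewrite -raddfMn fact_zeta; elim: n => [|n IH]; first by rewrite big_ord0.
rewrite big_ord_recr /=; apply: augP_M => //; apply: augP_B; first by rewrite aug_var.
by rewrite raddfMn /= aug1 mul0rn.
Qed.

Lemma mIntR_ind : (forall n x, P (aug (zeta n x))) -> forall a, P a.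
Proof.
by move=> Pz a; have [q _ ->] := aug_surj a; elim/(@IntZ_ind X): q.
Qed.

End Induction.

End Reduction.

(** * Torsion-freeness *)

Section Separation.
Variables (R : comNzRingType) (M : lmodType R) (T : tensor_model M).
Variables (K : choiceType) (phi : K -> M -> R^o) (b : K -> M).
Hypothesis phiL : forall i, linear (phi i).
Hypothesis phi_basis : forall a, exists E : {fset K}, forall E' : {fset K},
  (E `<=` E')%fset -> a = \sum_(i <- E') phi i a *: b i.
Local Notation tin := (tm_in T).

(** Coordinates in degree three, where [d (d a)] lies for [a] in degree one; 0 is the default on
    other lengths. *)
Definition tri_coord i j l : T -> R^o := tm_lift (fun w : seq M =>
  if w is [:: x; y; z] then phi i x * phi j y * phi l z : R^o else 0).

Lemma tri_multilinear i j l : multilinear (fun w : seq M =>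
  if w is [:: x; y; z] then phi i x * phi j y * phi l z : R^o else 0).
Proof.
have ringl (c u v y z : R) : (c * u + v) * y * z = c * (u * y * z) + v * y * z by ring.
have ringm (c u v y z : R) : y * (c * u + v) * z = c * (y * u * z) + y * v * z by ring.
have ringr (c u v y z : R) : y * z * (c * u + v) = c * (y * z * u) + y * z * v by ring.
move=> [|x [|y [|z [|u w]]]] [|x' [|y' [|z' w']]] c a a' //=;
  rewrite ?scaler0 ?addr0 // phiL.
- exact: ringl.
- exact: ringm.
- exact: ringr.
Qed.

Lemma tri_coord_linear i j l : linear (tri_coord i j l).
Proof. exact/tm_lift_linear/tri_multilinear. Qed.

(** Two summands, or the three letters of a word, need a common index set; hence the quantification
    over every [E'] containing [E]. *)
Lemma tri_coordK t : grade 3 t -> exists E : {fset K}, forall E' : {fset K},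
  (E `<=` E')%fset -> t = \sum_(i <- E') \sum_(j <- E') \sum_(l <- E')
    tri_coord i j l t *: (tin (b i) * tin (b j) * tin (b l)).
Proof.
move: t; apply: grade_ind => [|c u v [E hE] [F hF]|[|x [|y [|z []]]] // _].
- exists fset0 => E _; rewrite big1 // => i _; rewrite big1 // => j _.
  rewrite big1 // => l _; rewrite (linear_map0 (tri_coord_linear i j l)).
  exact: scale0r.
- exists (E `|` F)%fset => E'; rewrite fsubUset => /andP[EE FE].
  rewrite {1}(hE _ EE) {1}(hF _ FE).
  rewrite scaler_sumr -big_split; apply: eq_bigr => i _ /=.
  rewrite scaler_sumr -big_split; apply: eq_bigr => j _ /=.
  rewrite scaler_sumr -big_split; apply: eq_bigr => l _ /=.
  by rewrite tri_coord_linear scalerDl -scalerA.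
have [E hx] := phi_basis x; have [F hy] := phi_basis y; have [G hz] := phi_basis z.
exists (E `|` (F `|` G))%fset => E'; rewrite !fsubUset => /and3P[EE FE GE].
have expand a : a = \sum_(i <- E') phi i a *: b i ->
    tin a = \sum_(i <- E') phi i a *: tin (b i).
  by move=> h; rewrite {1}h linear_sum; apply: eq_bigr => i _; rewrite linearZ_LR.
have scaleM (r s : R) (u v : T) : (r *: u) * (s *: v) = (r * s) *: (u * v).
  by rewrite -scalerAl -scalerAr scalerA.
have wE : word T [:: x; y; z] = tin x * tin y * tin z.
  by rewrite !word_cons word_nil mulr1 mulrA.
transitivity (\sum_(i <- E') \sum_(j <- E') \sum_(l <- E')
    (phi i x * phi j y * phi l z) *: (tin (b i) * tin (b j) * tin (b l))); last first.
  apply: eq_bigr => i _; apply: eq_bigr => j _; apply: eq_bigr => l _.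
  by rewrite /tri_coord lift_word //; apply: tri_multilinear.
rewrite wE (expand x (hx _ EE)) (expand y (hy _ FE)) (expand z (hz _ GE)).
rewrite !mulr_suml; apply: eq_bigr => i _.
rewrite [_ * \sum_(j <- E') phi j y *: _]mulr_sumr mulr_suml.
apply: eq_bigr => j _; rewrite mulr_sumr; apply: eq_bigr => l _.
by rewrite !scaleM.
Qed.

Lemma tri_coord_sep t : grade 3 t -> (forall i j l, tri_coord i j l t = 0) -> t = 0.
Proof.
move=> /tri_coordK[E /(_ E (fsubset_refl E)) tE] t0; rewrite tE.
rewrite big1 // => i _; rewrite big1 // => j _; rewrite big1 // => l _.
by rewrite t0 scale0r.
Qed.

End Separation.

Section TorsionFree.
Variable X : choiceType.
Local Notation m := (mIntR CoefZ X).
Variable T : tensor_model m.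

Lemma aug_scale (c : coef_ring CoefZ) (q : IntZ X) :
  aug CoefZ ((c : int) *: q) = c *: aug CoefZ q.
Proof.
rewrite -[c *: q]/(q *~ c) raddfMz /= -scaler_int; congr (_ *: _).
exact: intz.
Qed.

Lemma tensor3_torsion_free (t : T) n : grade 3 t -> (0 < n)%N -> t *+ n = 0 -> t = 0.
Proof.
pose phi (i : {cmonom X}) (a : m) : (coef_ring CoefZ)^o := zcoef i (m_val a : IntZ X).
have phiL i : linear (phi i).
  by move=> c a b; apply: (zcoef_linear i).
(* Apply [aug] to the Newton expansion. The index 1 contributes [aug 1 = 0]; a spanning family is
   enough for separation. *)
have basis (a : m) : exists E : {fset {cmonom X}}, forall E' : {fset {cmonom X}},
    (E `<=` E')%fset -> a = \sum_(i <- E') phi i a *: aug CoefZ (zbasis i).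
  have [q q0 ->] := aug_surj a.
  have vE : m_val (aug CoefZ q) = q by rewrite augE q0 subr0.
  exists (msupp (zcoord q)) => E' le.
  rewrite {1}(zcoefK q) raddf_sum [LHS](big_fset_incl _ le) => [|i _ /mcoeff_outdom h].
    by apply: eq_bigr => i _ /=; rewrite aug_scale /phi vE.
  have -> : zcoef i q = 0 by apply: (@intr_inj rat); rewrite zcoefE h.
  by rewrite scale0r raddf0.
move=> ht n0 tn; apply: (tri_coord_sep phiL basis ht) => i j l.
have /eqP := linear_mapZ (tri_coord_linear (T := T) phiL i j l) n%:R t.
rewrite scaler_nat tn (linear_map0 (tri_coord_linear phiL i j l)) eq_sym.
by rewrite mulf_eq0 pnatr_eq0 eqn0Ngt n0 => /eqP.
Qed.

End TorsionFree.

(** * Binomial structures *)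

Lemma Fp_falling p (p_pr : prime p) (c : 'F_p) : \prod_(i < p) (c - i%:R) = 0.
Proof.
pose i := cast_ord (Fp_cast p_pr) c.
by rewrite (bigD1 i) //= natr_Zp subrr mul0r.
Qed.

Lemma coef_ring_int (k : coef) (r : coef_ring k) : exists c : int, r = c%:~R.
Proof.
case: k r => [|p p_pr] r /=; first by exists r; rewrite intz.
by exists (r : nat)%:Z; rewrite -pmulrn natr_Zp.
Qed.

Section DegreeZero.
Variables (R : comNzRingType) (M : lmodType R) (T : tensor_model M).

Lemma grade0_algebra : com_algebra_on (@grade R M T 0) *%R 1.
Proof.
split.
- exact: grade_submodule.
- split=> [a b ha hb|c a a' b _ _ _|c a b b' _ _ _].
  + exact: (gradeM ha hb).
  + exact: mulrPl.
  + exact: mulrPr.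
- by rewrite -word_nil; apply: (grade_word T [::]).
- by move=> a _; apply: mul1r.
- move=> _ _ /grade0P[a ->] /grade0P[b ->].
  by rewrite -!scalerAl -!scalerAr !mulr1 !scalerA mulrC.
- by move=> a b c _ _ _; apply: mulrA.
Qed.

Lemma grade0_scale_inj (c : R) : c *: (1 : T) = 0 -> c = 0.
Proof.
pose g (w : seq M) : R^o := if w is [::] then 1 else 0.
have gM : multilinear g by move=> [|x w] w' r a b /=; rewrite scaler0 addr0.
move/(congr1 (tm_lift g)); rewrite (linear_map0 (tm_lift_linear gM)).
rewrite (linear_mapZ (tm_lift_linear gM)) -word_nil lift_word //= => h.
by rewrite -[c]mulr1.
Qed.

Lemma grade0_falling (c : R) n :
  falling *%R 1 (c *: (1 : T)) n = (\prod_(i < n) (c - i%:R)) *: 1.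
Proof.
rewrite /falling -[RHS]/(in_alg T _) rmorph_prod; apply: eq_bigr => i _.
by rewrite rmorphB rmorph_nat.
Qed.

Lemma tin_inj : injective (tm_in T).
Proof.
pose g (w : seq M) : M := if w is [:: a] then a else 0.
have gM : multilinear g by apply: (@multilinear1 R M M id).
apply: (can_inj (g := tm_lift g)) => a; rewrite -word1.
by rewrite lift_word.
Qed.

End DegreeZero.

Section UnitizedFalling.
Variables (k : coef) (X : choiceType) (T : tensor_model (mIntR k X)).
Variable ops : cup_one_ops T.
Hypothesis opsP : cup_one_spec (@m_mul k X) ops.
Local Notation R := (coef_ring k).

(** A surjection onto [R (+) A^1] that takes products to [unitized_mul] ([uniM], [uni_surj]).
    Falling factorials in the unitization thereby become images of falling factorials of
    integer-valued polynomials. *)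
Definition uni (q : IntZ X) : (R^o * T)%type :=
  ((const_term q)%:~R, tm_in T (aug k q)).

Lemma uniB : zmod_morphism uni.
Proof.
by move=> q r; rewrite /uni const_termB rmorphB /= augB raddfB.
Qed.

HB.instance Definition _ :=
  GRing.isZmodMorphism.Build (IntZ X) (R^o * T)%type uni uniB.

Lemma uni1 : uni 1 = unitized_one T.
Proof. by rewrite /uni rmorph1 aug1 raddf0. Qed.

Lemma uniM : {morph uni : q r / q * r >-> unitized_mul ops q r}.
Proof.
move=> q r; rewrite /uni /unitized_mul /= rmorphM rmorphM /=; congr (_, _).
rewrite augM !raddfD /= !linearZ_LR (spec11 opsP).
by rewrite -addrA addrC.
Qed.

Lemma uni_surj x : unitized (@grade R _ T) x -> exists q, x = uni q.
Proof.
case: x => r t /grade1P[a /= ->]; have [q q0 ->] := aug_surj a.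
have [c ->] := coef_ring_int r; exists (q + c%:~R).
rewrite /uni rmorphD rmorph_int /= q0 add0r intz raddfD raddfMz /=.
by rewrite aug1 mul0rz addr0.
Qed.

Lemma uni_falling q n : falling (unitized_mul ops) (unitized_one T) (uni q) n =
  uni (\prod_(i < n) (q - i%:R)).
Proof.
rewrite /falling (big_morph uni uniM uni1); apply: eq_bigr => i _.
by rewrite -uni1 -raddfMn -raddfB.
Qed.

End UnitizedFalling.

Lemma tensor_binomial_Z (X : choiceType) (T : tensor_model (mIntR CoefZ X))
    (ops : cup_one_ops T) : cup_one_spec (@m_mul CoefZ X) ops ->
  binomial_algebra_on (@grade _ _ T 0) *%R 1 /\
  binomial_algebra_on (unitized (@grade _ _ T)) (unitized_mul ops) (unitized_one T).
Proof.
move=> opsP; split; split.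
- exact: grade0_algebra.
- split=> _ n /grade0P[c ->] n0.
    rewrite scalerMnl => /grade0_scale_inj/eqP.
    by rewrite mulrn_eq0 eqn0Ngt n0 => /eqP ->; rewrite scale0r.
  have [z hz] := int_ffact_dvd c n; exists ((z : coef_ring CoefZ) *: 1); split.
    by apply: gradeZ; rewrite -word_nil; apply: (grade_word T [::]).
  by rewrite grade0_falling [X in _ = X *: _]hz mulr_natr scalerMnl.
- exact: (tensor_unitized (@m_mulC CoefZ X) (@m_mulA CoefZ X) opsP).
split=> [[r t] n ht n0 rt|x n /uni_surj[q ->] n0].
  have rn : r *+ n = 0 by have := congr1 fst rt; rewrite (raddfMn fst).
  have tn : t *+ n = 0 by have := congr1 snd rt; rewrite (raddfMn snd).
  congr (_, _).
    by move/eqP: rn; rewrite mulrn_eq0 eqn0Ngt n0 => /eqP.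
  move/grade1P: ht tn => /= [a ->]; rewrite -raddfMn -(raddf0 (tm_in T)) => /tin_inj an.
  congr (tm_in T _); apply: val_inj; apply: (intz_torsion_free n0).
  have := congr1 (\val : mIntR CoefZ X -> IntR CoefZ X) an.
  by rewrite (raddfMn (\val : mIntR CoefZ X -> IntR CoefZ X)).
have [b hb] := intz_binomial q n; exists (uni T b); split; first exact: grade_tin.
by rewrite (uni_falling opsP) -hb raddfMn.
Qed.

Lemma tensor_binomial_Fp p (p_pr : prime p) (X : choiceType)
    (T : tensor_model (mIntR (CoefFp p_pr) X)) (ops : cup_one_ops T) :
  cup_one_spec (@m_mul (CoefFp p_pr) X) ops ->
  binomial_algebra_on (@grade _ _ T 0) *%R 1 /\
  binomial_algebra_on (unitized (@grade _ _ T)) (unitized_mul ops) (unitized_one T).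
Proof.
move=> opsP; split; split.
- exact: grade0_algebra.
- by move=> _ /grade0P[c ->]; rewrite grade0_falling Fp_falling // scale0r.
- exact: (tensor_unitized (@m_mulC _ X) (@m_mulA _ X) opsP).
move=> _ /uni_surj[q ->]; rewrite (uni_falling opsP); set Q := \prod_(i < p) _.
(* [uni Q] vanishes once the constant term of [Q] does, being a falling factorial in ['F_p], and its
   reduction does, being [q^p - q]. *)
have ctQ : (const_term Q)%:~R = 0 :> 'F_p.
  rewrite !rmorph_prod -[RHS](Fp_falling p_pr (const_term q)%:~R).
  by apply: eq_bigr => i _; rewrite !rmorphB /= !rmorph_nat.
have redQ : redR (CoefFp p_pr) X Q = 0.
  rewrite rmorph_prod -[RHS](subrr (redR (CoefFp p_pr) X q)).
  rewrite -[X in _ = X - _](Frobenius_fixed_IntZ p_pr (@projFp_zeta p p_pr X)).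
  rewrite -falling_Frobenius //; apply: eq_bigr => i _.
  by rewrite rmorphB rmorph_nat.
have augQ : aug (CoefFp p_pr) Q = 0.
  apply: val_inj; rewrite [LHS]augE redQ sub0r.
  by rewrite -[_%:~R]scaler_int [X in X *: _]ctQ scale0r oppr0.
by rewrite /uni augQ raddf0 [X in (X, _)]ctQ.
Qed.

Lemma tensor_binomial (k : coef) (X : choiceType) (T : tensor_model (mIntR k X))
    (ops : cup_one_ops T) : cup_one_spec (@m_mul k X) ops ->
  binomial_algebra_on (@grade _ _ T 0) *%R 1 /\
  binomial_algebra_on (unitized (@grade _ _ T)) (unitized_mul ops) (unitized_one T).
Proof.
by case: k T ops => [|p p_pr] T ops; [apply: tensor_binomial_Z|apply: tensor_binomial_Fp].
Qed.

(** * Vanishing of the square and the binomial cup-one dga *)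

Lemma square_zero_ind (k : coef) (X : choiceType) (T : tensor_model (mIntR k X))
    (d : {linear T -> T}) : degree_one (@grade _ _ T) d ->
  (forall a b, d (d (tm_in T a)) = 0 -> d (d (tm_in T b)) = 0 ->
     d (d (tm_in T (m_mul a b))) = 0) ->
  (forall x, d (d (tm_in T (m_var k x))) = 0) -> forall a, d (d (tm_in T a)) = 0.
Proof.
move=> d_degree dM dvar; pose P a := d (d (tm_in T a)) = 0.
have P0 : P 0 by rewrite /P !raddf0.
have PL c a b : P a -> P b -> P (c *: a + b).
  by rewrite /P !linearP => -> ->; rewrite scaler0 addr0.
apply: (mIntR_ind (P := P)) => // n x.
have := mIntR_fact_zeta P0 PL dM dvar n x; rewrite /P.
clear P P0 PL.
case: k T d d_degree dM dvar => [|p p_pr] T d d_degree dM dvar.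
  rewrite !raddfMn; apply: tensor3_torsion_free; rewrite ?fact_gt0 //.
  exact/d_degree/d_degree/grade_tin.
have [le_pn _|lt_np] := leqP p n.
  suff -> : aug (CoefFp p_pr) (zeta n x) = 0 by rewrite !raddf0.
  apply: val_inj; rewrite [LHS]augE const_term_zeta ?subr0; last first.
    exact: leq_trans (prime_gt0 p_pr) le_pn.
  exact: projFp_zeta.
rewrite -scaler_nat !linearZ_LR => /(congr1 ( *:%R n`!%:R^-1)).
by rewrite scalerA mulVf ?scale1r ?scaler0 // Fp_fact_neq0.
Qed.

Lemma tensor_alg_spec (R : comNzRingType) (M : lmodType R) (mu : M -> M -> M) :
  (forall b, linear (mu^~ b)) -> (forall a, linear (mu a)) ->
  cup_one_spec (T := tensor_alg_model M) mu
    (CupOneOps (tcup11 mu) (tcup21 mu) (tcirc mu)).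
Proof.
move=> mu_l mu_r; split.
- exact: tcup11E.
- exact: tcup21E.
- exact: tcircE.
- exact: tcup11_linearl.
- exact: tcup11_linearr.
- exact: tcup21_linearl.
- exact: tcup21_linearr.
- exact: tcirc_linearl.
- exact: tcirc_linearr.
Qed.

(** Stated for abstract models, which keeps the quotient construction folded; [U], over [R (+) M],
    hosts the coproduct. *)
Lemma square_zero_binomial_dga (k : coef) (X : choiceType) (T : tensor_model (mIntR k X))
    (U : tensor_model ((coef_ring k)^o * mIntR k X)%type)
    (ops : cup_one_ops T) (d : {linear T -> T}) : cup_one_spec (@m_mul k X) ops ->
  degree_one (@grade _ _ T) d ->
  (forall a b, grade 1 a -> grade 1 b -> cup1_d_formula d ops a b) ->
  graded_leibniz (@grade _ _ T) d ->
  ((forall x, d (d (tm_in T (m_var k x))) = 0) <-> (forall u, d (d u) = 0)) /\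
  ((forall u, d (d u) = 0) -> binomial_cup_one_dga (@grade _ _ T) d ops).
Proof.
move=> opsP d_degree d_cup1 d_leibniz.
have d_cup a b : cup1_d_formula d ops (tm_in T a) (tm_in T b).
  by apply: d_cup1; apply: grade_tin.
split=> [|d2]; first split=> [dvar|//].
  apply: (square_zero_gen d_degree d_leibniz); apply: square_zero_ind => // a b.
  exact: (square_zero_mul U (@m_mulC k X) (@m_mul_linearr k X) opsP d_degree d_cup).
have [bin0 binU] := tensor_binomial opsP; split=> //.
exact: (tensor_cup_one_dga d_degree d_leibniz (@m_mulC k X) (@m_mulA k X)
  (@m_mul_linearr k X) opsP d_cup d2).
Qed.

Theorem theorem1p1 (k : coef) (X : choiceType)
    (d : {linear freeT k X -> freeT k X}) :
  degree_one (@freeT_grade k X) d ->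
  (forall a b : freeT k X, freeT_grade 1%N a -> freeT_grade 1%N b ->
     cup1_d_formula d (freeT_ops k X) a b) ->
  graded_leibniz (@freeT_grade k X) d ->
  ((forall x : X, d (d (freeT_var k x)) = 0) <->
   (forall u : freeT k X, d (d u) = 0)) /\
  ((forall u : freeT k X, d (d u) = 0) ->
     binomial_cup_one_dga (@freeT_grade k X) d (freeT_ops k X)).
Proof.
(* For [tensor_alg_model], [grade] and [tm_in] unfold to [tgrade] and [tin], so both statements
   agree by conversion. *)
exact: (@square_zero_binomial_dga k X (tensor_alg_model _) (tensor_alg_model _)
  (freeT_ops k X) d
  (tensor_alg_spec (@m_mul_linearl k X) (@m_mul_linearr k X))).
Qed.
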